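(* Let $\Lambda$ be a left hereditary ring. The stable category $\Lambda\text{-}\underline{\mathrm{Mod}}$ of left $\Lambda$-modules is abelian if and only if the injective envelope of the left module ${}_{\Lambda}\Lambda$ is projective. The class of left hereditary rings $\Lambda$ such that the injective envelope of ${}_{\Lambda}\Lambda$ is projective consists precisely of finite direct products of complete blocked triangular matrix algebras over division rings.
   Context: Rings are associative with identity; modules are left modules. The (projectively) stable category $\Lambda\text{-}\underline{\mathrm{Mod}}$ has all left $\Lambda$-modules as objects; its morphisms $A\to B$ are the equivalence classes of $\Lambda$-homomorphisms $A\to B$, where $f$ and $g$ are equivalent if $f-g$ factors through a projective module. A ring is called a complete blocked triangular matrix ring (algebra) over a division ring $D$ if there is a finite-dimensional $D$-space $V$ and a chain of subspaces $V\supseteq V_1\supseteq\dots\supseteq V_k=(0)$ such that the ring consists of all $D$-linear transformations $\lambda$ of $V$ with $\lambda(V_i)\subseteq V_i$ for all $i=1,\dots,k$. Rings are considered up to isomorphism. *)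

(* Defs.v *)
From HB Require Import structures.
From mathcomp Require Import all_boot all_algebra.
From mathcomp Require Import boolp.

Set Implicit Arguments.
Unset Strict Implicit.
Unset Printing Implicit Defensive.

Import GRing.Theory.
Local Open Scope ring_scope.
Local Open Scope quotient_scope.

(* Rings are [pzRingType]s, so the zero ring is allowed; [lmodType R] is the
   type of left R-modules. *)

Section Modules.
Variable R : pzRingType.

Definition projective (P : lmodType R) : Prop :=
  forall (A B : lmodType R) (g : {linear A -> B}) (f : {linear P -> B}),
    (forall y, exists x, g x = y) ->
    exists h : {linear P -> A}, forall x, g (h x) = f x.

Definition injective_module (E : lmodType R) : Prop :=
  forall (A B : lmodType R) (i : {linear A -> B}) (f : {linear A -> E}),
    injective i ->
    exists h : {linear B -> E}, forall x, h (i x) = f x.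

Definition essential_mono (M E : lmodType R) (i : {linear M -> E}) : Prop :=
  injective i /\
  forall S : {pred E}, submod_closed S ->
    (exists2 x, x \in S & x != 0) ->
    exists2 m, i m \in S & i m != 0.

Definition injective_envelope (M E : lmodType R) (i : {linear M -> E}) : Prop :=
  injective_module E /\ essential_mono i.

End Modules.

(* A left ideal is a submodule I of the regular left module R^o; a structure
   [subLmodType I] on M identifies the module M with I through [val]. *)
Definition left_hereditary (R : pzRingType) : Prop :=
  forall (I : {pred R^o}) (M : subLmodType I), projective M.

(* Injective envelopes exist and are unique up to isomorphism. *)
Definition projective_injective_envelope (R : pzRingType) : Prop :=
  exists (E : lmodType R) (i : {linear R^o -> E}),
    injective_envelope i /\ projective E.

Record preadditive_category := PreadditiveCategory {
  obj :> Type;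
  hom : obj -> obj -> zmodType;
  idm : forall A, hom A A;
  comp : forall A B C, hom B C -> hom A B -> hom A C;
  comp1m : forall A B (f : hom A B), comp (idm B) f = f;
  compm1 : forall A B (f : hom A B), comp f (idm A) = f;
  compmA : forall A B C D (h : hom C D) (g : hom B C) (f : hom A B),
    comp h (comp g f) = comp (comp h g) f;
  compmDl : forall A B C (g g' : hom B C) (f : hom A B),
    comp (g + g') f = comp g f + comp g' f;
  compmDr : forall A B C (g : hom B C) (f f' : hom A B),
    comp g (f + f') = comp g f + comp g f'
}.
Arguments hom {p} A B.
Arguments idm {p} A.
Arguments comp {p A B C} g f.

Section Abelian.
Variable C : preadditive_category.
Implicit Types A B K Z : C.

Definition zero_object Z : Prop :=
  forall A, (exists! f : hom Z A, True) /\ (exists! f : hom A Z, True).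

Definition biproduct A B (S : C) (i1 : hom A S) (i2 : hom B S)
    (p1 : hom S A) (p2 : hom S B) : Prop :=
  [/\ comp p1 i1 = idm A, comp p2 i2 = idm B
    & comp i1 p1 + comp i2 p2 = idm S].

Definition monic A B (f : hom A B) : Prop :=
  forall X (u v : hom X A), comp f u = comp f v -> u = v.

Definition epic A B (f : hom A B) : Prop :=
  forall X (u v : hom B X), comp u f = comp v f -> u = v.

Definition is_kernel A B (f : hom A B) K (k : hom K A) : Prop :=
  comp f k = 0 /\
  forall X (h : hom X A), comp f h = 0 -> exists! u : hom X K, comp k u = h.

Definition is_cokernel A B (f : hom A B) K (c : hom B K) : Prop :=
  comp c f = 0 /\
  forall X (h : hom B X), comp h f = 0 -> exists! u : hom K X, comp u c = h.

Record abelian : Prop := Abelian {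
  abelian_zero : exists Z, zero_object Z;
  abelian_biproduct : forall A B, exists (S : C) (i1 : hom A S) (i2 : hom B S)
    (p1 : hom S A) (p2 : hom S B), biproduct i1 i2 p1 p2;
  abelian_kernel : forall A B (f : hom A B),
    exists K (k : hom K A), is_kernel f k;
  abelian_cokernel : forall A B (f : hom A B),
    exists K (c : hom B K), is_cokernel f c;
  abelian_monic : forall A B (f : hom A B), monic f ->
    exists K (g : hom B K), is_kernel g f;
  abelian_epic : forall A B (f : hom A B), epic f ->
    exists K (g : hom K A), is_cokernel g f
}.

End Abelian.

Section LinearMaps.
Variable R : pzRingType.

Lemma linear_funP (A B : lmodType R) (f g : {linear A -> B}) : f =1 g -> f = g.
Proof.
case: f g => [f [[a] [b]]] [g [[a'] [b']]] /= /funext fg; subst g.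
by rewrite (Prop_irrelevance a a') (Prop_irrelevance b b').
Qed.

Section Zmodule.
Variables A B : lmodType R.

HB.instance Definition _ := gen_eqMixin {linear A -> B}.
HB.instance Definition _ := gen_choiceMixin {linear A -> B}.

Definition linear_zero : {linear A -> B} := \0.
Definition linear_opp (f : {linear A -> B}) : {linear A -> B} := \- f.
Definition linear_add (f g : {linear A -> B}) : {linear A -> B} := f \+ g.

Lemma linear_addA : associative linear_add.
Proof. by move=> f g h; apply: linear_funP => x /=; rewrite addrA. Qed.
Lemma linear_addC : commutative linear_add.
Proof. by move=> f g; apply: linear_funP => x /=; rewrite addrC. Qed.
Lemma linear_add0 : left_id linear_zero linear_add.
Proof. by move=> f; apply: linear_funP => x /=; rewrite add0r. Qed.
Lemma linear_addN : left_inverse linear_zero linear_opp linear_add.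
Proof. by move=> f; apply: linear_funP => x /=; rewrite addNr. Qed.

HB.instance Definition _ := GRing.isZmodule.Build {linear A -> B}
  linear_addA linear_addC linear_add0 linear_addN.

End Zmodule.

Definition linear_of (A B : lmodType R) (f : A -> B) (f_lin : linear f) :
  {linear A -> B} := HB.pack f (GRing.isLinear.Build R A B *:%R f f_lin).

Definition linear_id (A : lmodType R) : {linear A -> A} := idfun.
Definition linear_comp (A B C : lmodType R) (g : {linear B -> C})
  (f : {linear A -> B}) : {linear A -> C} := g \o f.

End LinearMaps.

Section StableCategory.
Variable R : pzRingType.

Definition factors_projective (A B : lmodType R) (f : {linear A -> B}) : Prop :=
  exists P : lmodType R, projective P /\
    exists (a : {linear A -> P}) (b : {linear P -> B}), f = linear_comp b a.

Lemma projective_rV0 : projective 'rV[R]_0.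
Proof.
by move=> A B g f _; exists \0 => x /=; rewrite linear0 (thinmx0 x) linear0.
Qed.

Lemma projective_pair (P Q : lmodType R) :
  projective P -> projective Q -> projective (P * Q)%type.
Proof.
move=> projP projQ A B g f g_surj.
have inl_lin : linear (fun x : P => (x, 0 : Q)).
  by move=> a x y; apply/pair_equal_spec; rewrite /= scaler0 addr0.
have inr_lin : linear (fun y : Q => (0 : P, y)).
  by move=> a x y; apply/pair_equal_spec; rewrite /= scaler0 addr0.
have [h hE] := projP A B g (linear_comp f (linear_of inl_lin)) g_surj.
have [k kE] := projQ A B g (linear_comp f (linear_of inr_lin)) g_surj.
exists ((h \o fst) \+ (k \o snd)) => -[x y] /=.
rewrite linearD hE kE /= -linearD; congr (f _).
by apply/pair_equal_spec; rewrite /= addr0 add0r.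
Qed.

Definition null_maps (A B : lmodType R) : {pred {linear A -> B}} :=
  [pred f | `[< factors_projective f >]].

Lemma null_maps_zmod_closed (A B : lmodType R) : zmod_closed (@null_maps A B).
Proof.
split.
  apply/asboolP; exists 'rV[R]_0; split; first exact: projective_rV0.
  by exists \0, \0; apply: linear_funP.
move=> f g /asboolP[P [projP [a [b fE]]]] /asboolP[Q [projQ [c [d gE]]]].
apply/asboolP; exists (P * Q)%type; split; first exact: projective_pair.
have ac_lin : linear (fun x : A => (a x, c x)).
  by move=> t x y; apply/pair_equal_spec; rewrite !linearP.
exists (linear_of ac_lin), ((b \o fst) \- (d \o snd)).
by apply: linear_funP => x; rewrite fE gE.
Qed.

HB.instance Definition _ (A B : lmodType R) :=
  GRing.isZmodClosed.Build {linear A -> B} (@null_maps A B)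
    (@null_maps_zmod_closed A B).

(* [Quotient.quot I] identifies f and g when f - g \in I. *)
Definition stable_hom (A B : lmodType R) : zmodType :=
  Quotient.quot (@null_maps A B).

Definition stable_class (A B : lmodType R) (f : {linear A -> B}) :
  stable_hom A B := \pi_(Quotient.quot (@null_maps A B)) f.

Definition stable_comp (A B C : lmodType R) (g : stable_hom B C)
    (f : stable_hom A B) : stable_hom A C :=
  stable_class (linear_comp (repr g) (repr f)).

Lemma stable_classP (A B : lmodType R) (f g : {linear A -> B}) :
  stable_class f = stable_class g <-> factors_projective (f - g).
Proof.
split=> [/eqP | fg]; first by rewrite -Quotient.idealrBE => /asboolP.
by apply/eqP; rewrite -Quotient.idealrBE; apply/asboolP.
Qed.

Lemma stable_class_repr (A B : lmodType R) (f : stable_hom A B) :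
  stable_class (repr f) = f.
Proof. exact: reprK. Qed.

Lemma stable_classD (A B : lmodType R) (f g : {linear A -> B}) :
  stable_class (f + g) = stable_class f + stable_class g.
Proof. exact: (raddfD (\pi_(Quotient.quot (@null_maps A B)))). Qed.

Lemma stable_compE (A B C : lmodType R) (g : {linear B -> C})
    (f : {linear A -> B}) :
  stable_comp (stable_class g) (stable_class f) =
  stable_class (linear_comp g f).
Proof.
set f' := repr (stable_class f); set g' := repr (stable_class g).
have /stable_classP[P [projP [a [b fE]]]] : stable_class f' = stable_class f.
  exact: stable_class_repr.
have /stable_classP[Q [projQ [c [d gE]]]] : stable_class g' = stable_class g.
  exact: stable_class_repr.
apply: (@etrans _ _ (stable_class (linear_comp g' f))); apply/stable_classP.
  exists P; split=> //; exists a, (linear_comp g' b); apply: linear_funP => x.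
  have /= <- := congr1 (fun h : {linear A -> B} => h x) fE.
  by rewrite linearB.
exists Q; split=> //; exists (linear_comp c f), d; apply: linear_funP => x.
exact: (congr1 (fun h : {linear B -> C} => h (f x)) gE).
Qed.

Lemma stable_comp1m (A B : lmodType R) (f : stable_hom A B) :
  stable_comp (stable_class (linear_id B)) f = f.
Proof.
rewrite -[f]stable_class_repr stable_compE; congr stable_class.
exact: linear_funP.
Qed.

Lemma stable_compm1 (A B : lmodType R) (f : stable_hom A B) :
  stable_comp f (stable_class (linear_id A)) = f.
Proof.
rewrite -[f]stable_class_repr stable_compE; congr stable_class.
exact: linear_funP.
Qed.

Lemma stable_compA (A B C D : lmodType R) (h : stable_hom C D)
    (g : stable_hom B C) (f : stable_hom A B) :
  stable_comp h (stable_comp g f) = stable_comp (stable_comp h g) f.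
Proof.
rewrite -[f]stable_class_repr -[g]stable_class_repr -[h]stable_class_repr.
by rewrite !stable_compE; congr stable_class; apply: linear_funP.
Qed.

Lemma stable_compDl (A B C : lmodType R) (g g' : stable_hom B C)
    (f : stable_hom A B) :
  stable_comp (g + g') f = stable_comp g f + stable_comp g' f.
Proof.
rewrite -[f]stable_class_repr -[g]stable_class_repr -[g']stable_class_repr.
rewrite -stable_classD !stable_compE -stable_classD; congr stable_class.
exact: linear_funP.
Qed.

Lemma stable_compDr (A B C : lmodType R) (g : stable_hom B C)
    (f f' : stable_hom A B) :
  stable_comp g (f + f') = stable_comp g f + stable_comp g f'.
Proof.
rewrite -[f]stable_class_repr -[f']stable_class_repr -[g]stable_class_repr.
rewrite -stable_classD !stable_compE -stable_classD; congr stable_class.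
by apply: linear_funP => x /=; rewrite linearD.
Qed.

Definition stable_category : preadditive_category :=
  @PreadditiveCategory (lmodType R) stable_hom
    (fun A => stable_class (linear_id A)) stable_comp
    stable_comp1m stable_compm1 stable_compA stable_compDl stable_compDr.

End StableCategory.

Section EndomorphismRing.
Variables (R : pzRingType) (V : lmodType R).

Definition lend : Type := {linear V -> V}.

HB.instance Definition _ := GRing.Zmodule.on lend.

Definition lend_mul (f g : lend) : lend := linear_comp f g.

Lemma lend_mulA : associative lend_mul.
Proof. by move=> f g h; apply: linear_funP. Qed.
Lemma lend_mul1f : left_id (linear_id V : lend) lend_mul.
Proof. by move=> f; apply: linear_funP. Qed.
Lemma lend_mulf1 : right_id (linear_id V : lend) lend_mul.
Proof. by move=> f; apply: linear_funP. Qed.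
Lemma lend_mulDl : left_distributive lend_mul +%R.
Proof. by move=> f g h; apply: linear_funP. Qed.
Lemma lend_mulDr : right_distributive lend_mul +%R.
Proof. by move=> f g h; apply: linear_funP => x /=; rewrite linearD. Qed.

HB.instance Definition _ := GRing.Zmodule_isPzRing.Build lend
  lend_mulA lend_mul1f lend_mulf1 lend_mulDl lend_mulDr.

Variables (I : Type) (U : I -> submodClosed V).

Definition stabilizer : {pred lend} :=
  [pred f : lend | `[< forall i x, x \in U i -> (f : {linear V -> V}) x \in U i >]].

Lemma stabilizer_subring_closed : subring_closed stabilizer.
Proof.
split; first by apply/asboolP.
  move=> f g /asboolP fU /asboolP gU; apply/asboolP => i x Ux.
  have [_ UB] := GRing.submod_closedB (GRing.submodClosedP (U i)).
  exact: (UB _ _ (fU i x Ux) (gU i x Ux)).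
move=> f g /asboolP fU /asboolP gU; apply/asboolP => i x Ux.
by apply: fU; apply: gU.
Qed.

Record stabilizer_ring : Type := StabilizerRing {
  stabilizer_map :> lend;
  _ : stabilizer_map \in stabilizer
}.

HB.instance Definition _ := [isSub for stabilizer_map].
HB.instance Definition _ := [Choice of stabilizer_ring by <:].
HB.instance Definition _ := GRing.SubChoice_isSubPzRing.Build
  lend stabilizer stabilizer_ring stabilizer_subring_closed.

End EndomorphismRing.

Definition division_ring (D : unitRingType) : Prop :=
  forall x : D, x != 0 -> x \is a GRing.unit.

Definition ring_isomorphic (R S : pzRingType) : Prop :=
  exists f : {rmorphism R -> S}, bijective f.

(* [U i] is the subspace V_{i+1}, so [U ord_max] is the last term (0) of the
   chain; [vectType D] is the type of finite-dimensional left D-spaces (right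
   D-spaces are left spaces over the opposite division ring). *)
Definition subspace_chain (D : nzRingType) (V : lmodType D) (k : nat)
    (U : 'I_k.+1 -> submodClosed V) : Prop :=
  (forall i j : 'I_k.+1, (i <= j)%N -> {subset U j <= U i}) /\
  (forall x, x \in U ord_max -> x = 0).

Definition complete_blocked_triangular (S : pzRingType) : Prop :=
  exists D : unitRingType, division_ring D /\
  exists (V : vectType D) (k : nat) (U : 'I_k.+1 -> submodClosed V),
    subspace_chain U /\ ring_isomorphic S (stabilizer_ring U).

(* The map r |-> (p i r)_i to the direct product of the S i, with its
   componentwise operations, is an isomorphism. *)
Definition direct_product (R : pzRingType) (n : nat) (S : 'I_n -> pzRingType) :
    Prop :=
  exists p : forall i, {rmorphism R -> S i}, bijective (fun r i => p i r).

Definition finite_product_blocked_triangular (R : pzRingType) : Prop :=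
  exists (n : nat) (S : 'I_n -> pzRingType),
    (forall i, complete_blocked_triangular (S i)) /\ direct_product R S.

(* Main.v *)
(* The stable category.  Let R be hereditary with injective envelope E.  The
   projection p : E -> E / R is stably monic, since its kernel R is projective.  If the stable category is abelian then p is
   the stable kernel of some g; a map E -> E / R killed by g therefore lifts
   stably along p, and essentiality of R in E turns this into the statement that
   the identity of E factors through a projective module.

   The structure theorem.  Let E be projective and injective.  Over a hereditary
   ring a map into a projective module that vanishes on an essential submodule is
   zero, so E is finitely generated, essential closures in E are unique, and E has
   no infinite family of orthogonal nonzero idempotent endomorphisms: such a
   family would produce a submodule of E that is not projective.  Hence E is a
   finite sum of indecomposable projective injective modules, any nonzero map
   between two of these is bijective, and D = End V is a division ring for each of
   them.  A nonzero D-stable submodule of V is cyclic and local, so the submodules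
   of V form a finite chain of D-subspaces.  R acts faithfully on the finitely many
   nonisomorphic modules V, and since R, being hereditary, is a sum of images of
   submodules of the V, every family of D-linear maps preserving the chains is
   given by an element of R.

   The converse.  For a product of blocked triangular rings every submodule of a
   standard module V is a term of the chain and is projective, and V is injective
   because an essential left ideal contains all rank one maps onto the bottom of
   the chain.  Finitely many of these rank one maps cut out the torsion part of any
   module; it has a projective complement, so that the stable category is
   equivalent to the category of torsion modules, which is closed under submodules
   and quotients. *)

Require Import Defs.
From HB Require Import structures.
From mathcomp Require Import all_boot all_algebra.
From mathcomp Require Import boolp classical_sets functions.

Set Implicit Arguments.
Unset Strict Implicit.
Unset Printing Implicit Defensive.

Import GRing.Theory Num.Theory.
Local Open Scope ring_scope.
Local Open Scope quotient_scope.
Local Open Scope classical_set_scope.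

(** * Submodules and quotients *)

Section Submodules.
Variable R : pzRingType.
Implicit Types L M N : lmodType R.

Definition submod M (U : M -> Prop) : Prop :=
  U 0 /\ forall (a : R) x y, U x -> U y -> U (a *: x + y).

Section SubmodTheory.
Variables (M : lmodType R) (U : M -> Prop) (subU : submod U).

Lemma submod0 : U 0. Proof. by case: subU. Qed.
Lemma submodD x y : U x -> U y -> U (x + y).
Proof. by move=> Ux Uy; rewrite -[x]scale1r; apply: subU.2. Qed.
Lemma submodZ a x : U x -> U (a *: x).
Proof. by move=> Ux; rewrite -[a *: x]addr0; apply: subU.2 => //; exact: submod0. Qed.
Lemma submodN x : U x -> U (- x).
Proof. by move=> Ux; rewrite -scaleN1r; apply: submodZ. Qed.
Lemma submodB x y : U x -> U y -> U (x - y).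
Proof. by move=> Ux Uy; apply: submodD => //; apply: submodN. Qed.

Lemma submod_closed_asbool : submod_closed (fun x : M => `[< U x >]).
Proof.
split; first by apply/asboolP; exact: submod0.
by move=> a x y /asboolP Ux /asboolP Uy; apply/asboolP; apply: subU.2.
Qed.

Definition submod_pred : submodClosed M :=
  HB.pack (fun x : M => `[< U x >])
    (GRing.isSubmodClosed.Build R M (fun x : M => `[< U x >]) submod_closed_asbool).

End SubmodTheory.

Section SubModule.
Variables (M : lmodType R) (S : submodClosed M).

Record sub_module := SubModule { sub_module_val :> M; _ : sub_module_val \in S }.
HB.instance Definition _ := [isSub for sub_module_val].
HB.instance Definition _ := [Choice of sub_module by <:].
HB.instance Definition _ := [SubChoice_isSubLmodule of sub_module by <:].
End SubModule.

Lemma submod_exists M (U : M -> Prop) : submod U ->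
  exists (S : lmodType R) (i : {linear S -> M}),
    injective i /\ forall x, U x <-> exists s, i s = x.
Proof.
move=> subU; pose S := submod_pred subU.
exists (sub_module S), (\val : {linear sub_module S -> M}).
split; first exact: val_inj.
move=> x; split=> [Ux | [s <-]]; last by apply/asboolP; exact: (valP s).
have Sx : x \in S by apply/asboolP.
by exists (SubModule Sx).
Qed.

(** For any choice function of [G] the defect of linearity lies in the fibre over 0, which is
    trivial. Most maps below are built from relations in this way. *)
Lemma graph_linear M N (G : M -> N -> Prop) :
    submod (fun z : M * N => G z.1 z.2) ->
    (forall x, exists y, G x y) -> (forall y, G 0 y -> y = 0) ->
  exists h : {linear M -> N}, forall x, G x (h x).
Proof.
move=> subG totG unG; have [h hG] := choice totG.
have hlin : linear h.
  move=> a x y; apply/eqP; rewrite -subr_eq0; apply/eqP/unG.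
  have -> : 0 = (a *: x + y) - (a *: x + y) :> M by rewrite subrr.
  apply: (submodB subG (x := (_, _)) (y := (_, _))) => //=.
  exact: (subG.2 a (_, _) (_, _) (hG x) (hG y)).
by exists (linear_of hlin) => x; exact: hG.
Qed.

Lemma linear_inj M N (f : {linear M -> N}) :
  (forall x, f x = 0 -> x = 0) -> injective f.
Proof.
move=> kf x y fxy; apply/eqP; rewrite -subr_eq0; apply/eqP/kf.
by rewrite linearB /= fxy subrr.
Qed.

Lemma submod_ker M N (f : {linear M -> N}) : submod (fun x => f x = 0).
Proof.
split=> [|a x y fx fy]; first exact: linear0.
by rewrite linearP fx fy scaler0 addr0.
Qed.

Lemma submod_im M N (f : {linear M -> N}) : submod (fun y => exists x, f x = y).
Proof.
split=> [|a _ _ [x <-] [y <-]]; first by exists 0; rewrite linear0.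
by exists (a *: x + y); rewrite linearP.
Qed.

Lemma linear_inv M N (f : {linear M -> N}) :
  injective f -> (forall y, exists x, f x = y) ->
  exists g : {linear N -> M}, cancel f g /\ cancel g f.
Proof.
move=> injf surjf; have [|//||g gE] := @graph_linear N M (fun y x => f x = y).
- split=> [|a [y x] [y' x'] /= <- <-] /=; first by rewrite linear0.
  by rewrite linearP.
- by move=> x; rewrite -(linear0 f) => /injf.
by exists g; split=> [x|y //]; apply: injf; rewrite gE.
Qed.

Lemma factor_inj L M N (i : {linear L -> N}) (f : {linear M -> N}) :
  injective i -> (forall x, exists y, i y = f x) ->
  exists g : {linear M -> L}, forall x, i (g x) = f x.
Proof.
move=> inji fi; have [|//||g gE] := @graph_linear M L (fun x y => i y = f x); last by exists g.
  by split=> [|a [x y] [x' y'] /= e e'] /=; rewrite ?linear0 // !linearP e e'.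
by move=> y; rewrite linear0 -(linear0 i) => /inji.
Qed.

Lemma factor_surj L M N (p : {linear M -> L}) (f : {linear M -> N}) :
  (forall y, exists x, p x = y) -> (forall x, p x = 0 -> f x = 0) ->
  exists g : {linear L -> N}, forall x, g (p x) = f x.
Proof.
move=> surjp pf.
have [|||g gE] := @graph_linear L N (fun y z => exists2 x, p x = y & f x = z).
- split=> [|a [x y] [x' y'] [u /= <- <-] [v /= <- <-]] /=.
    by exists 0; rewrite linear0.
  by exists (a *: u + v); rewrite linearP.
- by move=> y; have [x xE] := surjp y; exists (f x), x.
- by move=> y [x /pf -> <-].
exists g => x; have [x' xx' <-] := gE (p x).
apply/eqP; rewrite -subr_eq0 -linearB /=; apply/eqP/pf.
by rewrite linearB /= xx' subrr.
Qed.

Section QuotientModule.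
Variables (M : lmodType R) (U : M -> Prop) (subU : submod U).

Lemma zmod_closed_asbool : zmod_closed (fun x : M => `[< U x >]).
Proof.
split; first by apply/asboolP; exact: (submod0 subU).
by move=> x y /asboolP Ux /asboolP Uy; apply/asboolP; apply: (submodB subU).
Qed.

Let S : zmodClosed M :=
  HB.pack (fun x : M => `[< U x >])
    (GRing.isZmodClosed.Build M (fun x : M => `[< U x >]) zmod_closed_asbool).

Definition quotient_module := Quotient.quot S.
HB.instance Definition _ := GRing.Zmodule.on quotient_module.

Definition quotient_pi (x : M) : quotient_module := \pi_(Quotient.quot S) x.
Definition quotient_scale (a : R) (q : quotient_module) : quotient_module :=
  quotient_pi (a *: repr q).

Lemma quotient_piP x y : quotient_pi x = quotient_pi y <-> U (x - y).
Proof.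
split=> [/eqP|xy]; first by rewrite -Quotient.idealrBE => /asboolP.
by apply/eqP; rewrite -Quotient.idealrBE; apply/asboolP.
Qed.

Lemma quotient_piB : {morph quotient_pi : x y / x - y}.
Proof. exact: (raddfB (\pi_(Quotient.quot S))). Qed.
Lemma quotient_piD : {morph quotient_pi : x y / x + y}.
Proof. exact: (raddfD (\pi_(Quotient.quot S))). Qed.

Lemma quotient_reprK q : quotient_pi (repr q) = q. Proof. exact: reprK. Qed.

Lemma quotient_scaleE a x : quotient_scale a (quotient_pi x) = quotient_pi (a *: x).
Proof.
apply/quotient_piP; rewrite -scalerBr; apply: (submodZ subU).
by apply/quotient_piP; exact: quotient_reprK.
Qed.

Lemma quotient_scaleA a b q :
  quotient_scale a (quotient_scale b q) = quotient_scale (a * b) q.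
Proof. by rewrite -[q]quotient_reprK !quotient_scaleE scalerA. Qed.
Lemma quotient_scale1 : left_id 1 quotient_scale.
Proof. by move=> q; rewrite -[q]quotient_reprK quotient_scaleE scale1r. Qed.
Lemma quotient_scaleDr : right_distributive quotient_scale +%R.
Proof.
move=> a q r; rewrite -[q]quotient_reprK -[r]quotient_reprK.
by rewrite -quotient_piD !quotient_scaleE -quotient_piD scalerDr.
Qed.
Lemma quotient_scaleDl q : {morph quotient_scale^~ q : a b / a + b}.
Proof.
move=> a b; rewrite -[q]quotient_reprK.
by rewrite !quotient_scaleE -quotient_piD scalerDl.
Qed.

HB.instance Definition _ := GRing.Zmodule_isLmodule.Build R quotient_module
  quotient_scaleA quotient_scale1 quotient_scaleDr quotient_scaleDl.

Lemma quotient_pi_linear : linear quotient_pi.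
Proof. by move=> a x y; rewrite quotient_piD -quotient_scaleE. Qed.

End QuotientModule.

Lemma quotient_exists M (U : M -> Prop) : submod U ->
  exists (Q : lmodType R) (p : {linear M -> Q}),
    (forall y, exists x, p x = y) /\ forall x, p x = 0 <-> U x.
Proof.
move=> subU.
exists (quotient_module subU), (linear_of (quotient_pi_linear subU)); split=> [y|x /=].
  by exists (repr y); exact: quotient_reprK.
have -> : 0 = quotient_pi subU 0 by rewrite -[in RHS](subrr 0) quotient_piB subrr.
by rewrite quotient_piP subr0.
Qed.

Lemma submod_zorn M (P : set M -> Prop) (U0 : set M) :
    submod U0 -> P U0 ->
    (forall F : set (set M), (exists U, F U) -> total_on F subset ->
       (forall U, F U -> submod U /\ U0 `<=` U /\ P U) -> P (\bigcup_(U in F) U)) ->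
  exists U, [/\ submod U, U0 `<=` U, P U
    & forall U' : set M, submod U' -> U `<=` U' -> P U' -> U' `<=` U].
Proof.
move=> sub0 P0 Pchain.
pose Q (U : set M) := U = set0 \/ [/\ submod U, U0 `<=` U & P U].
have [F FQ Ftot|U [QU Umax]] := @Zorn_bigcup M Q.
  pose F' := [set U | F U /\ U !=set0].
  have F'Q U : F' U -> submod U /\ U0 `<=` U /\ P U.
    by move=> [/FQ[-> [x []]|[]]].
  have UE : (\bigcup_(U in F) U = \bigcup_(U in F') U).
    apply/seteqP; split=> x [U FU Ux]; exists U => //; last by case: FU.
    by split=> //; exists x.
  have [[U F'U]|F'0] := pselect (exists U, F' U); last first.
    left; rewrite UE; apply/seteqP; split=> // x [U F'U Ux].
    by case: F'0; exists U.
  right; rewrite UE; have F'tot : total_on F' subset.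
    by move=> V W [FV _] [FW _]; exact: Ftot.
  split; last by apply: Pchain => //; exists U.
    split; first by exists U => //; exact: submod0 (F'Q _ F'U).1.
    move=> a x y [V FV Vx] [W FW Wy].
    have [VW|WV] := F'tot _ _ FV FW.
      by exists W => //; apply: (F'Q _ FW).1.2 => //; exact: VW.
    by exists V => //; apply: (F'Q _ FV).1.2 => //; exact: WV.
  by move=> x U0x; exists U => //; exact: (F'Q _ F'U).2.1.
have {}Umax U' : Q U' -> U `<=` U' -> U' `<=` U.
  move=> QU' UU'; apply: contrapT => U'U; apply: (Umax U') => //; split=> //.
case: QU => [U_0|[subU U0U PU]].
  have := Umax U0 (or_intror (And3 sub0 (fun x h => h) P0)).
  by rewrite U_0 => /(_ (@sub0set _ _)) /(_ 0 (submod0 sub0)).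
exists U; split=> // U' subU' UU' PU'; apply: Umax => //.
by right; split=> //; apply: subset_trans UU'.
Qed.

End Submodules.

(** * Injective modules *)

Section Injectives.
Variable R : pzRingType.
Implicit Types L M N E B : lmodType R.

(** [G] is a linear map on its domain, a submodule of [B], and injectivity of [E] extends it. *)
Lemma injective_graph E B (G : B -> E -> Prop) : injective_module E ->
    submod (fun z : B * E => G z.1 z.2) -> (forall e, G 0 e -> e = 0) ->
  exists h : {linear B -> E}, forall b e, G b e -> h b = e.
Proof.
move=> injE subG unG.
have unG2 b e e' : G b e -> G b e' -> e = e'.
  move=> Ge Ge'; apply/eqP; rewrite -subr_eq0; apply/eqP/unG.
  by have := submodB subG (x := (_, _)) (y := (_, _)) Ge Ge'; rewrite /= subrr.
have subD : submod (fun b => exists e, G b e).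
  split=> [|a x y [e Ge] [e' Ge']]; first by exists 0; exact: (submod0 subG).
  by exists (a *: e + e'); exact: (subG.2 a (_, _) (_, _) Ge Ge').
have [S [i [inji iD]]] := submod_exists subD.
have [|s|e|g gE] := @graph_linear R S E (fun s e => G (i s) e).
- split=> [|a [x y] [x' y'] /= Gx Gy] /=; first by rewrite linear0; exact: (submod0 subG).
  by rewrite linearP; exact: (subG.2 a (_, _) (_, _) Gx Gy).
- by apply/iD; exists s.
- by rewrite linear0; exact: unG.
have [h hE] := injE S B i g inji.
exists h => b e Gb; have /iD[s sb] : exists e, G b e by exists e.
by rewrite -sb hE; apply: unG2 (gE s) _; rewrite sb.
Qed.

(* Essential left ideals suffice because the domain of a maximal partial
   extension is essential. *)
Lemma baer_criterion E :
    (forall (S : lmodType R) (i : {linear S -> R^o}) (g : {linear S -> E}),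
       injective i ->
       (forall x : R, x != 0 -> exists a, a * x != 0 /\ exists s, i s = a * x) ->
       exists v, forall s, g s = (i s : R) *: v) ->
  injective_module E.
Proof.
move=> baerE A B i f inji.
pose G0 : set (B * E) := [set z | exists2 a, i a = z.1 & f a = z.2].
pose P (G : set (B * E)) := forall e, G (0, e) -> e = 0.
have sub0 : submod G0.
  split=> [|t [x y] [x' y'] [a /= <- <-] [a' /= <- <-]]; first by exists 0; rewrite linear0.
  by exists (t *: a + a'); rewrite linearP.
have P0 : P G0 by move=> e [a /=]; rewrite -(linear0 i) => /inji -> <-; rewrite linear0.
have [|G [subG G0G PG Gmax]] := @submod_zorn R _ P G0 sub0 P0.
  by move=> F _ _ FP e [U FU Ue]; have [_ [_]] := FP _ FU; apply.
pose D b := exists e, G (b, e).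
have subD : submod D.
  split=> [|a x y [e Ge] [e' Ge']]; first by exists 0; exact: (submod0 subG).
  by exists (a *: e + e'); exact: (subG.2 a (_, _) (_, _) Ge Ge').
have essD x : x != 0 -> exists a : R, a *: x != 0 /\ D (a *: x).
  move=> xN0; apply: contrapT => nD.
  have nDx a : D (a *: x) -> a *: x = 0.
    by move=> Da; apply: contra_notP nD => ax0; exists a; split=> //; apply/eqP.
  (* If R x meets [D] only in 0, the partial map extends by sending [x] to 0, against maximality. *)
  pose G' : set (B * E) := [set z | exists a, G (z.1 - a *: x, z.2)].
  have subG' : submod G'.
    split=> [|t [b e] [b' e'] [a Ga] [a' Ga']].
      by exists 0; rewrite scale0r subr0; exact: (submod0 subG).
    have : G (t *: (b - a *: x) + (b' - a' *: x), t *: e + e') := subG.2 t _ _ Ga Ga'.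
    by exists (t * a + a'); rewrite /= scalerDl -scalerA opprD addrACA -scalerBr.
  apply: nD; exists 1; rewrite scale1r; split=> //; exists 0.
  apply: (Gmax G' subG').
  - by move=> [b e] Gbe; exists 0; rewrite /= scale0r subr0.
  - move=> e [a /=]; rewrite sub0r => Ga.
    have ax0 : a *: x = 0.
      apply: nDx; exists (- e); rewrite -[a *: x]opprK; exact: (submodN subG Ga).
    by move: Ga; rewrite ax0 oppr0; exact: PG.
  - by exists 1; rewrite /= scale1r subrr; exact: (submod0 subG).
have DT b : D b.
  (* Since [D] is essential, so is the ideal of all r with r b in [D]. By [baerE] the partial map on
     it is multiplication by some [v], and [G] extends by sending [b] to [v]. *)
  have subI : submod (fun r : R^o => D ((r : R) *: b)).
    split=> [|a x y Dx Dy]; first by rewrite scale0r; exact: (submod0 subD).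
    by have := subD.2 a _ _ Dx Dy; rewrite scalerA -scalerDl.
  have [S [j [injj jI]]] := submod_exists subI.
  have [|s|e|g gE] := @graph_linear R S E (fun s e => G ((j s : R) *: b, e)).
  - split=> [|a [x y] [x' y'] /= Gx Gy] /=.
      by rewrite linear0 scale0r; exact: (submod0 subG).
    rewrite linearP; have := subG.2 a (_, _) (_, _) Gx Gy.
    by rewrite /= scalerDl -scalerA.
  - by apply/jI; exists s.
  - by rewrite linear0 scale0r; exact: PG.
  have [|v vE] := baerE S j g injj.
    move=> x xN0; have [xb0|/eqP xbN0] := pselect (x *: b = 0).
      exists 1; rewrite mul1r; split=> //; apply/jI.
      by rewrite xb0; exact: (submod0 subD).
    have [a [axN0 Da]] := essD _ xbN0.
    exists a; split; last by apply/jI; rewrite -scalerA.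
    by apply: contra_neq axN0 => ax0; rewrite scalerA ax0 scale0r.
  pose G' : set (B * E) := [set z | exists r : R, G (z.1 - r *: b, z.2 - r *: v)].
  exists v; apply: (Gmax G').
  - split=> [|t [c e] [c' e'] [a Ga] [a' Ga']].
      by exists 0; rewrite !scale0r !subr0; exact: (submod0 subG).
    have : G (t *: (c - a *: b) + (c' - a' *: b), t *: (e - a *: v) + (e' - a' *: v)).
      exact: subG.2 t _ _ Ga Ga'.
    exists (t * a + a'); rewrite /= !scalerDl -!scalerA !opprD.
    by rewrite (addrACA (t *: c)) (addrACA (t *: e)) -!scalerBr.
  - by move=> [c e] Gce; exists 0; rewrite /= !scale0r !subr0.
  - move=> e [r /=]; rewrite sub0r => Gr.
    have /jI[s sr] : D (r *: b).
      by exists (- (e - r *: v)); rewrite -[r *: b]opprK; exact: (submodN subG Gr).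
    have := submodD subG Gr (gE s); rewrite /= sr vE.
    have -> : (- (r *: b), e - r *: v) + (r *: b, j s *: v) = (0, e) :> B * E.
      by apply/pair_equal_spec; rewrite /= addNr sr subrK.
    exact: PG.
  - by exists 1; rewrite /= !scale1r !subrr; exact: (submod0 subG).
have [|//|//|h hE] := @graph_linear R B E (fun b e => G (b, e)).
  by move: subG => -[G00 GZ]; split=> [//|a [x y] [x' y'] /=]; exact: GZ.
exists h => x; apply/eqP; rewrite -subr_eq0; apply/eqP/PG.
have G0x : G (i x, f x) by apply: G0G; exists x.
have -> : (0, h (i x) - f x) = (i x, h (i x)) - (i x, f x) :> B * E.
  by apply/pair_equal_spec; rewrite /= subrr.
exact: (submodB subG).
Qed.

Lemma complement_exists M (H : M -> Prop) : submod H ->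
  exists C : set M, [/\ submod C, forall x, H x -> C x -> x = 0
   & forall C' : set M, submod C' -> C `<=` C' ->
       (forall x, H x -> C' x -> x = 0) -> C' `<=` C].
Proof.
move=> subH; pose P (C : set M) := forall x, H x -> C x -> x = 0.
have sub0 : submod [set 0 : M].
  by split=> // a x y -> ->; rewrite /= scaler0 addr0.
have P0 : P [set 0] by move=> x _.
have [|C [subC C0 PC Cmax]] := submod_zorn sub0 P0; last first.
  exists C; split=> // C' subC' CC' PC'; apply: Cmax => //.
by move=> F _ _ FP x Hx [U FU Ux]; have [_ [_]] := FP _ FU; apply.
Qed.

(** By maximality C + R x meets [H]; in other words, the image of [H] in M / C is essential. *)
Lemma complement_essential M (H C : set M) : submod H -> submod C ->
    (forall C' : set M, submod C' -> C `<=` C' ->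
       (forall x, H x -> C' x -> x = 0) -> C' `<=` C) ->
  forall x, ~ C x -> exists (a : R) h c, [/\ H h, C c, h != 0 & a *: x = h + c].
Proof.
move=> subH subC Cmax x nCx; apply: contra_notP nCx => nE.
pose C' : set M := [set z | exists a : R, C (z - a *: x)].
apply: (Cmax C').
- split=> [|t y y' [a Ca] [a' Ca']].
    by exists 0; rewrite scale0r subr0; exact: (submod0 subC).
  exists (t * a + a'); have := subC.2 t _ _ Ca Ca'.
  by rewrite scalerDl -scalerA opprD addrACA -scalerBr.
- by move=> y Cy; exists 0; rewrite scale0r subr0.
- move=> h Hh [a Ca]; apply: contrapT => /eqP hN0; apply: nE.
  exists a, h, (- (h - a *: x)); split=> //; first exact: (submodN subC).
  by rewrite opprB addrC subrK.
- by exists 1; rewrite scale1r subrr; exact: (submod0 subC).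
Qed.

End Injectives.

(** * Dual bases of projective modules *)

Section Combinations.
Variables (R : pzRingType) (P : lmodType R).
Implicit Types s : seq (R * P).

(** A list of pairs encodes an element of the free module on the underlying set of [P]: [comb s] is
    its coefficient function and [comb_eval s] its image under the canonical map onto [P]. *)
Definition comb s (b : P) : R := \sum_(p <- s) (if p.2 == b then p.1 else 0).
Definition comb_eval s : P := \sum_(p <- s) p.1 *: p.2.

Lemma comb_out s b : b \notin map snd s -> comb s b = 0.
Proof.
move=> bs; rewrite /comb big_seq big1 // => p ps; case: eqP => // pb.
by case/negP: bs; rewrite -pb; exact: map_f.
Qed.

Lemma comb_evalE s : comb_eval s = \sum_(t <- undup (map snd s)) comb s t *: t.
Proof.
rewrite /comb_eval /comb; under [RHS]eq_bigr do rewrite scaler_suml.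
rewrite exchange_big /= big_seq [RHS]big_seq; apply: eq_bigr => p ps.
have ps2 : p.2 \in undup (map snd s) by rewrite mem_undup; exact: map_f.
rewrite (bigD1_seq p.2) ?undup_uniq //= eqxx big1 ?addr0 // => t.
by rewrite eq_sym => /negPf ->; rewrite scale0r.
Qed.

Lemma comb_cat s1 s2 : comb (s1 ++ s2) = comb s1 \+ comb s2.
Proof. by apply: funext => b; rewrite /comb big_cat. Qed.
Lemma comb_eval_cat s1 s2 : comb_eval (s1 ++ s2) = comb_eval s1 + comb_eval s2.
Proof. by rewrite /comb_eval big_cat. Qed.

Definition comb_scale (a : R) s := [seq (a * p.1, p.2) | p <- s].
Lemma comb_scaleE a s : comb (comb_scale a s) = (fun b => a * comb s b).
Proof.
apply: funext => b; rewrite /comb big_map mulr_sumr.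
by apply: eq_bigr => p _ /=; case: eqP; rewrite ?mulr0.
Qed.
Lemma comb_eval_scale a s : comb_eval (comb_scale a s) = a *: comb_eval s.
Proof.
by rewrite /comb_eval big_map scaler_sumr; apply: eq_bigr => p _ /=; rewrite scalerA.
Qed.

Lemma comb_eval_eq0 s : comb s =1 (fun=> 0) -> comb_eval s = 0.
Proof. by move=> s0; rewrite comb_evalE big1 // => t _; rewrite s0 scale0r. Qed.

End Combinations.

(** The canonical map from the free module on the set [P] onto [P] splits; the functionals [c t] are
    the coordinates of a splitting. *)
Lemma projective_dual_basis (R : pzRingType) (P : lmodType R) : projective P ->
  exists c : P -> {linear P -> R^o}, forall x, exists s : seq P,
    (forall t, t \notin s -> c t x = 0) /\ x = \sum_(t <- s) (c t x : R) *: t.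
Proof.
move=> projP.
pose F (f : P -> R^o) := exists s : seq (R * P), f = comb s.
have subF : submod F.
  split=> [|a _ _ [s ->] [s' ->]].
    by exists [::]; apply: funext => b; rewrite /comb big_nil.
  exists (comb_scale a s ++ s'); rewrite comb_cat comb_scaleE; exact: funext.
have [S [i [inji iF]]] := submod_exists subF.
have [|s|y|ev evE] := @graph_linear R S P
    (fun f y => exists2 s, i f = comb s & y = comb_eval s).
- split=> [|a [f y] [f' y'] /= [s fs ->] [s' fs' ->]] /=.
    exists [::]; last by rewrite /comb_eval big_nil.
    by rewrite linear0; apply: funext => b; rewrite /comb big_nil.
  exists (comb_scale a s ++ s'); last by rewrite comb_eval_cat comb_eval_scale.
  by rewrite linearP fs fs' comb_cat comb_scaleE; exact: funext.
- have /iF[s' ss'] : exists f, i f = i s by exists s.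
  by exists (comb_eval s'), s'.
- by move=> [s]; rewrite linear0 => s0 ->; apply: comb_eval_eq0; rewrite -s0.
have ev_surj y : exists f, ev f = y.
  have /iF[f fE] : F (comb [:: (1, y)]) by exists [:: (1, y)].
  exists f; have [s sE ->] := evE f.
  have : comb_eval (comb_scale (-1) s ++ [:: (1, y)]) = 0.
    apply: comb_eval_eq0 => b.
    by rewrite comb_cat comb_scaleE /= -fE sE mulN1r addNr.
  rewrite comb_eval_cat comb_eval_scale /comb_eval big_seq1 /= scaleN1r scale1r.
  by rewrite addrC => /eqP; rewrite subr_eq0 => /eqP ->.
have [h hE] := projP S P ev (linear_id P) ev_surj.
have clin t : linear (fun x => i (h x) t : R^o) by move=> a x y; rewrite !linearP.
exists (fun t => linear_of (clin t)) => x; have [s sE xE] := evE (h x).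
exists (undup (map snd s)); split=> [t|/=].
  by rewrite mem_undup => ts; rewrite /= sE comb_out.
by rewrite -[LHS]hE xE comb_evalE sE.
Qed.

(** * Embedding modules into injective modules *)

Lemma divisible_injective (E : lmodType int) :
  (forall (n : nat) (d : E), (0 < n)%N -> exists e, n%:Z *: e = d) -> injective_module E.
Proof.
move=> divE; apply: baer_criterion => S i g inji ess.
have [a [aN0 [s0 s0a]]] := ess 1 (oner_neq0 _); rewrite mulr1 in aN0 s0a.
pose P n := (0 < n)%N && `[< exists s, i s = n%:Z >].
have exP : exists n, P n.
  exists `|a|%N; rewrite /P absz_gt0 aN0; apply/asboolP.
  by exists (sgz a *: s0); rewrite linearZ /= s0a abszEsg.
(* The least positive element [n] of the ideal generates it, by division with remainder; so an [e]
   with n e = g s determines the extension. *)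
case: (ex_minnP exP) => n /andP[n_gt0 /asboolP[s sn]] nmin.
have [e eE] := divE n (g s) n_gt0.
exists e => t; pose q := (i t %/ n%:Z)%Z.
have nN0 : n%:Z != 0 by rewrite eqz_nat -lt0n.
have tE : i (t - q *: s) = (i t %% n%:Z)%Z.
  by rewrite linearB linearZ /= sn {1}(divz_eq (i t) n%:Z) addrC addKr.
have : i (t - q *: s) = 0.
  rewrite tE; apply/eqP/negPn/negP => rN0.
  have := modz_ge0 (i t) nN0; have := ltz_pmod (i t) (n_gt0 : 0 < n%:Z).
  move: rN0 tE; case: (i t %% n%:Z)%Z => // r rN0 tE rn _.
  suff : (n <= r)%N by rewrite leqNgt -ltz_nat rn.
  by apply: nmin; rewrite /P lt0n rN0; apply/asboolP; exists (t - q *: s).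
rewrite -(linear0 i) => /inji /eqP; rewrite subr_eq0 => /eqP ->.
by rewrite !linearZ /= sn -eE scalerA.
Qed.

Lemma fct_mulrz (T : Type) (M : zmodType) (f : T -> M) (k : int) t :
  (f *~ k) t = f t *~ k.
Proof.
have fn n : (f *+ n) t = f t *+ n by elim: n => [|n IHn] //; rewrite !mulrS -IHn.
by case: k => n; rewrite /intmul /= -fn.
Qed.

(* [D] is the quotient of the group of functions [A -> rat] by the kernel of the
   evaluation [Z^(A) -> A], where [Z^(A)] is the group of finitely supported
   integer valued functions. *)
Lemma embed_divisible (A : zmodType) : exists D : lmodType int,
  injective_module D /\ exists j : {linear (zmodule A) -> D}, injective j.
Proof.
pose Az : lmodType int := zmodule A; pose F : lmodType int := zmodule (A -> rat).
pose K (f : F) := exists s : seq (int * Az),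
  (forall b, (f : A -> rat) b = (comb s b)%:~R) /\ comb_eval s = 0.
have subK : submod K.
  split=> [|a f g [s [fs s0]] [t [gt t0]]].
    by exists [::]; split=> [b|]; rewrite ?/comb ?/comb_eval big_nil.
  exists (comb_scale a s ++ t); split=> [b|]; last first.
    by rewrite comb_eval_cat comb_eval_scale s0 t0 scaler0 addr0.
  rewrite comb_cat comb_scaleE /= intrD intrM -fs -gt.
  by rewrite mulrzl -fct_mulrz.
have [Q [p [surjp pK]]] := quotient_exists subK.
pose delta (a : A) : F := fun b : A => (comb ([:: (1, a)] : seq (int * Az)) b)%:~R.
have jlin : linear (fun a : Az => p (delta a)).
  move=> k a b; apply/eqP; rewrite -subr_eq0 -!linearP -linearB /=; apply/eqP/pK.
  exists [:: (1, k *: a + b); (- k, a); (- 1, b)]; split=> [c|].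
    have -> : (delta (k *: a + b) - (k *: delta a + delta b)) c =
        delta (k *: a + b) c - (delta a c *~ k + delta b c).
      by rewrite -fct_mulrz.
    rewrite /delta /comb !big_cons !big_nil /= !addr0.
    case: (_ == c); case: (a == c); case: (b == c);
      by rewrite ?intrD ?mulrNz ?mulr0z ?addr0 ?add0r ?oppr0 ?opprD ?mul0rz ?subr0 ?sub0r ?addrA.
  by rewrite /comb_eval !big_cons big_nil /= addr0 scale1r scaleNr scaleN1r -opprD subrr.
exists Q; split.
  apply: divisible_injective. move=> n d n_gt0; have [f fE] := surjp d.
  exists (p (fun b => (f : A -> rat) b / n%:R)); rewrite -linearZ -fE; congr (p _).
  apply: funext => b; rewrite scalezrE /= .
  rewrite fct_mulrz -mulrzl mulrC divfK //.
  by rewrite pnatr_eq0 -lt0n.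
exists (linear_of jlin); apply: linear_inj => a /= /pK [s [sE s0]].
have : comb_eval (comb_scale (-1) s ++ [:: (1, a)]) = 0.
  apply: comb_eval_eq0 => b; rewrite comb_cat comb_scaleE /= mulN1r.
  apply/eqP; rewrite addrC subr_eq0; apply/eqP.
  by apply: (@intr_inj rat); rewrite -sE.
by rewrite comb_eval_cat comb_eval_scale s0 scaler0 add0r /comb_eval big_seq1 scale1r.
Qed.

Section Coinduced.
Variables (R : pzRingType) (D : lmodType int).

Definition coinduced : Type := {linear (zmodule R) -> D}.
HB.instance Definition _ := GRing.Zmodule.on coinduced.

Lemma coinduced_scale_subproof (a : R) (f : coinduced) :
  linear (fun x : zmodule R => (f : {linear (zmodule R) -> D}) ((x : R) * a)).
Proof.
move=> k x y.
have -> : (k *: x + y : R) * a = k *: ((x : R) * a : zmodule R) + (y : R) * a.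
  by rewrite mulrDl scalezrE mulrzAl.
exact: linearP.
Qed.

Definition coinduced_scale (a : R) (f : coinduced) : coinduced :=
  linear_of (coinduced_scale_subproof a f).

Lemma coinduced_scaleA a b f :
  coinduced_scale a (coinduced_scale b f) = coinduced_scale (a * b) f.
Proof. by apply: linear_funP => x /=; rewrite mulrA. Qed.
Lemma coinduced_scale1 : left_id 1 coinduced_scale.
Proof. by move=> f; apply: linear_funP => x /=; rewrite mulr1. Qed.
Lemma coinduced_scaleDr : right_distributive coinduced_scale +%R.
Proof. by move=> a f g; apply: linear_funP. Qed.
Lemma coinduced_scaleDl f : {morph coinduced_scale^~ f : a b / a + b}.
Proof.
by move=> a b; apply: linear_funP => x /=; rewrite mulrDr linearD.
Qed.

HB.instance Definition _ := GRing.Zmodule_isLmodule.Build R coinduced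
  coinduced_scaleA coinduced_scale1 coinduced_scaleDr coinduced_scaleDl.

End Coinduced.

Lemma additive_linearz (A B : lmodType int) (f : A -> B) :
  {morph f : x y / x + y} -> linear f.
Proof.
move=> fD k x y; rewrite fD; congr (_ + _).
have f0 : f 0 = 0 by apply: (addIr (f 0)); rewrite -fD !add0r.
have fn n : f (x *+ n) = f x *+ n.
  by elim: n => [|n IHn]; rewrite ?mulr0n ?f0 // !mulrS fD IHn.
have fN z : f (- z) = - f z by apply: (addIr (f z)); rewrite -fD !addNr f0.
have kE (M : lmodType int) (z : M) : k *: z = z *~ k.
  by rewrite -{1}[k]intz scaler_int.
by rewrite !kE; case: k {kE} => n; rewrite /intmul /= ?fN fn.
Qed.

(** Evaluation at 1 identifies R-linear maps into [coinduced R D] with additive maps into [D], so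
    the extension problem can be solved over the integers. *)
Lemma coinduced_injective (R : pzRingType) (D : lmodType int) :
  injective_module D -> @injective_module R (coinduced R D).
Proof.
move=> injD A B i g inji.
have ilin : linear (i : zmodule A -> zmodule B).
  exact: (@additive_linearz (zmodule A) (zmodule B) _ (linearD i)).
have glin : linear ((fun x => (g x : {linear (zmodule R) -> D}) 1) : zmodule A -> D).
  by apply: additive_linearz => x y; rewrite linearD.
have [h hE] := injD _ _ (linear_of ilin) (linear_of glin) inji.
have klin (b : B) : linear ((fun x : R => h (x *: b)) : zmodule R -> D).
  by apply: (@additive_linearz (zmodule R)) => x y; rewrite scalerDl linearD.
have llin : linear ((fun b => linear_of (klin b)) : B -> coinduced R D).
  move=> a b c; apply: linear_funP => x /=.
  by rewrite scalerDr scalerA linearD.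
exists (linear_of llin) => a; apply: linear_funP => x /=.
have /= := hE (x *: a : zmodule A); rewrite linearZ => ->.
by rewrite linearZ /= mul1r.
Qed.

(** The embedding is the adjoint of an additive embedding [j] into an injective abelian group;
    evaluating it at 1 gives [j] back. *)
Lemma enough_injectives (R : pzRingType) (A : lmodType R) :
  exists (E : lmodType R) (i : {linear A -> E}), injective_module E /\ injective i.
Proof.
have [D [injD [j injj]]] := embed_divisible A.
have klin (b : A) : linear ((fun x : R => j (x *: b)) : zmodule R -> D).
  by apply: (@additive_linearz (zmodule R)) => x y; rewrite scalerDl linearD.
have llin : linear ((fun b => linear_of (klin b)) : A -> coinduced R D).
  move=> a b c; apply: linear_funP => x /=.
  by rewrite scalerDr scalerA linearD.
exists (coinduced R D), (linear_of llin); split; first exact: coinduced_injective.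
move=> a b /(congr1 (fun f : {linear (zmodule R) -> D} => f 1)) /= /injj.
by rewrite !scale1r.
Qed.

(** * Hereditary rings and envelopes *)

Section Hereditary.
Variable R : pzRingType.
Implicit Types A B E L M N P Q S W X : lmodType R.

(** The form of [left_hereditary] used below: a left ideal is any injection into the regular module,
    not a predicate on it. *)
Definition ideals_projective :=
  forall (S : lmodType R) (i : {linear S -> R^o}), injective i -> projective S.

Definition essential_sub M (U : M -> Prop) :=
  forall x, x != 0 -> exists a : R, a *: x != 0 /\ U (a *: x).

Lemma projective_retract P S (a : {linear S -> P}) (b : {linear P -> S}) :
  projective P -> cancel a b -> projective S.
Proof.
move=> projP abK A B g f surjg.
have [h hE] := projP A B g (linear_comp f b) surjg.
by exists (linear_comp h a) => x; rewrite /= hE /= abK.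
Qed.

Lemma injective_retract E S (a : {linear S -> E}) (b : {linear E -> S}) :
  injective_module E -> cancel a b -> injective_module S.
Proof.
move=> injE abK A B i f inji.
have [h hE] := injE A B i (linear_comp a f) inji.
by exists (linear_comp b h) => x; rewrite /= hE /= abK.
Qed.

Lemma left_hereditaryP : left_hereditary R <-> ideals_projective.
Proof.
split=> [hR S i inji|hR I M]; last exact: (hR M val val_inj).
have subI := submod_im i.
pose I := submod_pred subI; have projI : projective (sub_module I) := hR _ _.
have [|a aE] := @factor_inj R _ _ _ (\val : {linear sub_module I -> R^o}) i val_inj.
  move=> x; have Ix : i x \in I by apply/asboolP; exists x.
  by exists (SubModule Ix).
have [|b bE] := @factor_inj R _ _ _ i (\val : {linear sub_module I -> R^o}) inji.
  by move=> y; have /asboolP := valP y.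
apply: (projective_retract projI (a := a) (b := b)) => x.
by apply: inji; rewrite bE aE.
Qed.

Lemma projective_regular : projective R^o.
Proof.
move=> A B g f surjg; have [a aE] := surjg (f 1).
have hlin : linear (fun r : R^o => (r : R) *: a) by move=> k x y; rewrite scalerDl scalerA.
exists (linear_of hlin) => x; rewrite /= linearZ /= aE -linearZ /=.
by congr (f _); exact: mulr1.
Qed.

Hypothesis hR : ideals_projective.

(** A map from an ideal to [Q] lifts to [E] because the ideal is projective, and the lift extends to
    R because [E] is injective. *)
Lemma injective_quotient E Q (p : {linear E -> Q}) :
  injective_module E -> (forall y, exists x, p x = y) -> injective_module Q.
Proof.
move=> injE surjp; apply: baer_criterion => S i g inji _.
have [h hE] := (hR inji : projective S) E Q p g surjp; have [k kE] := injE _ _ i h inji.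
exists (p (k 1)) => s; rewrite -hE -kE -linearZ -linearZ /=; congr (p (k _)).
by rewrite [RHS]mulr1.
Qed.

(* Lift along [A -> B] after embedding [A] in an injective [I]; the lift to [I]
   of a map into [A / ker g <= I / ker g] takes its values in [A]. *)
Lemma projective_sub P S (i : {linear S -> P}) :
  projective P -> injective i -> projective S.
Proof.
move=> projP inji A B g f surjg.
have [I [j [injI injj]]] := enough_injectives A.
have subK : submod (fun y => exists2 a, g a = 0 & j a = y).
  split=> [|t _ _ [a ga <-] [b gb <-]]; first by exists 0; rewrite linear0.
  by exists (t *: a + b); rewrite linearP ?ga ?gb ?scaler0 ?addr0.
have [Q [p [surjp pK]]] := quotient_exists subK.
have injQ := injective_quotient injI surjp.
have [k kE] : exists k : {linear B -> Q}, forall a, k (g a) = p (j a).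
  apply: (@factor_surj R B A Q g (linear_comp p j)) => // a ga /=.
  by apply/pK; exists a.
have [F FE] := injQ _ _ i (linear_comp k f) inji.
have [F' F'E] := projP _ _ p F surjp.
have [|h hE] := @factor_inj R A S I j (linear_comp F' i) injj.
  move=> s /=; have [a aE] := surjg (f s).
  have /pK[b gb bE] : p (F' (i s) - j a) = 0.
    by rewrite linearB /= F'E FE /= -aE kE subrr.
  by exists (b + a); rewrite linearD /= bE subrK.
exists h => s; have [a aE] := surjg (f s).
have : p (j (h s - a)) = 0.
  by rewrite linearB /= hE linearB /= F'E FE /= -aE kE subrr.
move=> /pK[b gb /injj bE]; apply/eqP; rewrite -subr_eq0 -aE -linearB /= -bE.
by rewrite gb.
Qed.

(** The image of [f] is a submodule of a projective module, hence projective, so it splits off from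
    [A]. Most later uses of heredity go through this factorization. *)
Lemma image_split A P (f : {linear A -> P}) : projective P ->
  exists W (j : {linear W -> P}) (a : {linear A -> W}) (b : {linear W -> A}),
    [/\ projective W, injective j, forall x, j (a x) = f x & cancel b a].
Proof.
move=> projP; have [W [j [injj jf]]] := submod_exists (submod_im f).
have projW := projective_sub projP injj.
have [|a aE] := @factor_inj R W A P j f injj.
  by move=> x; apply/jf; exists x.
have [|b bE] := projW A W a (linear_id W).
  move=> w; have /jf[x xE] : exists s, j s = j w by exists w.
  by exists x; apply: injj; rewrite aE.
by exists W, j, a, b; split.
Qed.

(** The kernel of [f] is a direct summand of [M]; as it contains an essential submodule, its
    complement is zero. *)
Lemma essential_eq0 M P (U : M -> Prop) (f : {linear M -> P}) :
  projective P -> essential_sub U -> (forall x, U x -> f x = 0) ->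
  forall x, f x = 0.
Proof.
move=> projP essU fU x; have [W [j [a [b [_ injj jaE baK]]]]] := image_split f projP.
rewrite -jaE; suff -> : a x = 0 by rewrite linear0.
apply/eqP/negPn/negP => axN0.
have baxN0 : b (a x) != 0.
  by apply: contra_neq axN0 => /(congr1 a); rewrite baK linear0.
have [t [tN0 Ut]] := essU _ baxN0.
move: tN0; rewrite -linearZ /= -(baK (t *: a x)) [a _](_ : _ = 0) ?linear0 ?eqxx //.
by apply: injj; rewrite jaE linearZ /= fU // linear0.
Qed.

Lemma essential_eq M P (U : M -> Prop) (f g : {linear M -> P}) :
  projective P -> essential_sub U -> (forall x, U x -> f x = g x) ->
  forall x, f x = g x.
Proof.
move=> projP essU fg x; apply/eqP; rewrite -subr_eq0; apply/eqP.
pose h : {linear M -> P} := f \- g.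
by apply: (essential_eq0 (f := h) projP essU) => y Uy /=; rewrite fg ?subrr.
Qed.

End Hereditary.

(** * Injective envelopes *)

Section Envelope.
Variable R : pzRingType.
Implicit Types A B E L M N P Q S W X : lmodType R.

Lemma essential_monoP M E (i : {linear M -> E}) :
  essential_mono i <-> injective i /\ essential_sub (fun x => exists m, i m = x).
Proof.
split=> [[inji ess]|[inji ess]]; split=> //.
  move=> x xN0; pose S : {pred E} := fun y => `[< exists a : R, a *: x = y >].
  have [||m /asboolP[a am] mN0] := ess S.
  - split=> [|a _ _ /asboolP[b <-] /asboolP[c <-]].
      by apply/asboolP; exists 0; rewrite scale0r.
    by apply/asboolP; exists (a * b + c); rewrite scalerDl scalerA.
  - by exists x => //; apply/asboolP; exists 1; rewrite scale1r.
  by exists a; rewrite am; split=> //; exists m.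
move=> S [S0 SZ] [x xS xN0]; have [a [aN0 [m mE]]] := ess x xN0.
exists m; rewrite mE //; rewrite -[a *: x]addr0.
by apply: SZ.
Qed.

(* A maximal essential extension of [M] inside the injective module [X] is a
   direct summand of [X]. *)
Lemma envelope_retract M X (i : {linear M -> X}) : injective_module X -> injective i ->
  exists E (j : {linear M -> E}) (a : {linear E -> X}) (b : {linear X -> E}),
    injective_envelope j /\ cancel a b.
Proof.
move=> injX inji; pose N : set X := [set x | exists m, i m = x].
have subN : submod N := submod_im i.
pose ess (H : set X) := forall x, H x -> x != 0 -> exists a : R, a *: x != 0 /\ N (a *: x).
have essN : ess N by move=> x Nx xN0; exists 1; rewrite scale1r.
have [|H [subH NH essH Hmax]] := submod_zorn subN essN.
  by move=> F _ _ FP x [U FU Ux]; have [_ [_]] := FP _ FU; apply.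
have [C [subC HC Cmax]] := complement_exists subH.
have [||p pE] := @injective_graph R X X (fun x y => H y /\ C (x - y)) injX.
- split=> [|t [x y] [x' y'] [/= Hy Cy] [/= Hy' Cy']].
    by split; rewrite ?subr0; exact: submod0.
  split; first exact: subH.2.
  by rewrite opprD addrACA -scalerBr; exact: subC.2.
- move=> y [Hy]; rewrite sub0r => /(submodN subC); rewrite opprK => Cy.
  exact: HC.
have pH x : H x -> p x = x.
  by move=> Hx; apply: pE; rewrite subrr; split=> //; exact: submod0.
have pC x : C x -> p x = 0.
  by move=> Cx; apply: pE; rewrite subr0; split=> //; exact: submod0.
have pHT x : H (p x).
  have : (fun y => exists x, p x = y) `<=` H; last by apply; exists x.
  apply: Hmax; first exact: submod_im.
  - by move=> y Hy; exists y; exact: pH.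
  - move=> _ [y <-] pyN0.
    have nCy : ~ C y by move=> Cy; move: pyN0; rewrite pC ?eqxx.
    have [a [h [c [Hh Cc hN0 E]]]] := complement_essential subH subC Cmax nCy.
    have [t [tN0 Nt]] := essH _ Hh hN0.
    exists (t * a); rewrite -scalerA -[a *: p y]linearZ /= E linearD /= pH // pC // addr0.
    by split.
have [E [a [inja aH]]] := submod_exists subH.
have [|b bE] := @factor_inj R E X X a p inja; first by move=> x; apply/aH.
have [|j jE] := @factor_inj R E M X a i inja.
  by move=> m; apply/aH/NH; exists m.
have abK : cancel a b.
  by move=> x; apply: inja; rewrite bE pH //; apply/aH; exists x.
exists E, j, a, b; split=> //; split; first exact: injective_retract abK.
apply/essential_monoP; split=> [x y /(congr1 a)|x xN0]; first by rewrite !jE => /inji.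
have axN0 : a x != 0 by apply: contra_neq xN0 => ax0; apply: inja; rewrite linear0.
have /essH/(_ axN0)[t [tN0 [m mE]]] : H (a x) by apply/aH; exists x.
exists t; split; first by apply: contra_neq tN0 => tx0; rewrite -linearZ /= tx0 linear0.
by exists m; apply: inja; rewrite jE mE linearZ.
Qed.

Lemma envelope_exists M : exists E (j : {linear M -> E}), injective_envelope j.
Proof.
have [X [i [injX inji]]] := enough_injectives M.
by have [E [j [a [b [envj _]]]]] := envelope_retract injX inji; exists E, j.
Qed.

Lemma projective_envelope X (i : {linear R^o -> X}) :
  injective_module X -> projective X -> injective i -> projective_injective_envelope R.
Proof.
move=> injX projX inji.
have [E [j [a [b [envj abK]]]]] := envelope_retract injX inji.
by exists E, j; split=> //; exact: projective_retract abK.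
Qed.

End Envelope.

(** * Stable categories *)

Section StableNull.
Variable R : pzRingType.
Implicit Types A B C E L M N P Q S W X : lmodType R.

Lemma stable_class0P A B (f : {linear A -> B}) :
  stable_class f = 0 <-> factors_projective f.
Proof.
have f0 : f - 0 = f by apply: linear_funP => x /=; rewrite subr0.
rewrite -{2}f0 -stable_classP; suff -> : stable_class (0 : {linear A -> B}) = 0 by [].
by apply: (addIr (stable_class (0 : {linear A -> B}))); rewrite -stable_classD !add0r.
Qed.

Lemma stable_class_eq A B (f g : {linear A -> B}) : f =1 g -> stable_class f = stable_class g.
Proof. by move=> fg; congr stable_class; exact: linear_funP. Qed.

Lemma projective_null A P B (a : {linear A -> P}) (b : {linear P -> B}) (f : {linear A -> B}) :
  projective P -> (forall x, f x = b (a x)) -> stable_class f = 0.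
Proof.
move=> projP fE; apply/stable_class0P; exists P; split=> //; exists a, b.
exact: linear_funP.
Qed.

Hypothesis hR : ideals_projective R.

(** If [f] factors through a map [a] into a projective module, the image of [a] splits off and is
    projective. The projection [q] onto the kernel of [a] is then stably the identity; it turns
    stable equations into equations between maps. *)
Lemma null_split A B (f : {linear A -> B}) : stable_class f = 0 ->
  exists q : {linear A -> A}, (forall x, f (q x) = 0) /\
    stable_class q = stable_class (linear_id A).
Proof.
move=> /stable_class0P[P [projP [a [b fE]]]].
have [W [j [c [d [projW _ jc dc]]]]] := image_split hR a projP.
pose q : {linear A -> A} := idfun \- (d \o c).
exists q; split=> [x|]; first by rewrite fE /= linearB /= -!jc dc subrr linear0.
apply/stable_classP/stable_class0P.
by apply: (projective_null (a := c) (b := \- d) projW) => x /=; rewrite addrAC subrr add0r.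
Qed.

Lemma abelian_projective_envelope :
  abelian (stable_category R) -> projective_injective_envelope R.
Proof.
move=> abel; have [E [i envi]] := envelope_exists R^o.
exists E, i; split=> //; have [injE /essential_monoP[inji essi]] := envi.
have [Q [p [surjp pK]]] := quotient_exists (submod_im i).
pose cls A B (f : {linear A -> B}) : @Defs.hom (stable_category R) A B := stable_class f.
have monp : Defs.monic (cls _ _ p).
  move=> X u v; rewrite -[u]stable_class_repr -[v]stable_class_repr.
  set u' := repr u; set v' := repr v => uv.
  (* The difference [w] is shown to be null: p w q = 0 for some [q] that is stably the identity, so
     w q takes its values in the kernel of [p], a copy of the projective module R. *)
  pose w : {linear X -> E} := u' \- v'.
  have wu : stable_class u' = stable_class v' + stable_class w.
    by rewrite -stable_classD; apply: stable_class_eq => x /=; rewrite addrC subrK.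
  have /null_split[q [pwq qid]] : stable_class (linear_comp p w) = 0.
    apply: (addrI (stable_class (linear_comp p v'))); rewrite addr0 -stable_classD.
    rewrite -[RHS]stable_compE; rewrite [RHS](_ : _ = Defs.comp (cls _ _ p) (stable_class v')) //.
    rewrite -uv /= stable_compE; apply: stable_class_eq => x /=.
    by rewrite -linearD /= addrC subrK.
  have [|k kE] := @factor_inj R _ _ _ i (linear_comp w q) inji.
    by move=> x; apply/pK; exact: pwq.
  have wq0 : stable_class (linear_comp w q) = 0.
    by apply: (projective_null (a := k) (b := i) (@projective_regular R)) => x; rewrite kE.
  by rewrite wu -[stable_class w]stable_compm1 -qid stable_compE wq0 addr0.
have [K [g [gp gker]]] := abelian_monic abel monp.
move: gp gker; rewrite -[g]stable_class_repr; set g' := repr g => gp gker.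
rewrite /= stable_compE in gp.
(* With [q] stably the identity of [E], the map g p q is zero on the nose, so [g] vanishes on the
   image [W] of p q. *)
have [q [gpq qid]] := null_split gp.
have [W [j [injj jE]]] := submod_exists (submod_im (linear_comp p q)).
have [|w wE] := @factor_inj R W E Q j (linear_comp p q) injj.
  by move=> x; apply/jE; exists x.
(* Hence the inclusion [j] of [W] lifts stably along [p] to [u], and u w is stably [q] because [p]
   is monic. *)
have [|u [pu _]] := gker W (cls _ _ j).
  rewrite /= stable_compE; apply: (projective_null (a := \0) (b := \0) (@projective_regular R)).
  move=> y /=; have /jE[x <-] : exists s, j s = j y by exists y.
  exact: gpq.
move: pu; rewrite -[u]stable_class_repr; set u' := repr u => pu.
have uw : stable_class (linear_comp u' w) = stable_class q.
  apply: monp; rewrite /= -stable_compE -[LHS]/(stable_comp _ _) stable_compA.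
  rewrite [stable_comp _ (stable_class u')]pu !stable_compE.
  by apply: stable_class_eq => x /=; rewrite wE.
pose d : {linear E -> E} := q \- (u' \o w).
have /null_split[q2 [dq2 q2id]] : stable_class d = 0.
  apply: (addrI (stable_class (linear_comp u' w))); rewrite addr0 -stable_classD uw.
  by apply: stable_class_eq => x /=; rewrite addrC subrK.
(* After [q2] the maps [q] and u' w agree exactly. A multiple of q (q2 x) lying in the image of [i]
   is killed by [p], so [w] vanishes at the corresponding point and the multiple is 0; essentiality
   gives q q2 = 0, and q q2 is stably the identity. *)
have qq2 x : q (q2 x) = 0.
  apply/eqP/negPn/negP => /essi[a [aN0 ima]]; move: aN0.
  rewrite -!linearZ /= in ima *; have := dq2 (a *: x) => /= /eqP.
  rewrite subr_eq0 => /eqP ->; rewrite (_ : w _ = 0) ?linear0 ?eqxx //.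
  by apply: injj; rewrite linear0 wE; apply/pK.
have /stable_class0P idnull : stable_class (linear_id E) = 0.
  rewrite -[LHS]stable_comp1m -{1}qid -q2id stable_compE.
  by apply: (projective_null (a := \0) (b := \0) (@projective_regular R)).
move: idnull => [P [projP [a [b idE]]]].
apply: (projective_retract projP (a := a) (b := b)) => x.
by have /= <- := congr1 (fun h : {linear E -> E} => h x) idE.
Qed.

End StableNull.

(** * The stable category as a category of torsion modules *)

Section TorsionAbelian.
Variables (R : pzRingType) (tau : seq R).
Implicit Types A B C E K L M N P Q S T W X : lmodType R.

Definition torsion M (x : M) : Prop := forall r, r \in tau -> r *: x = 0.

Lemma torsion_linear M N (f : {linear M -> N}) x : torsion x -> torsion (f x).
Proof. by move=> tx r rt; rewrite -linearZ /= tx // linear0. Qed.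

Hypothesis torsion_submod : forall M, submod (@torsion M).
Hypothesis torsion_projection : forall M, exists r : {linear M -> M},
  [/\ forall x, torsion (r x), forall x, torsion x -> r x = x
    & stable_class r = stable_class (linear_id M)].
Hypothesis torsion_null : forall M N (f : {linear M -> N}),
  factors_projective f -> forall x, torsion x -> f x = 0.

(** The projection onto the torsion part is stably the identity, so a stable map is determined by
    its restriction to torsion elements. The abelian axioms thereby reduce to statements about
    torsion submodules. *)
Lemma torsion_classP M N (f g : {linear M -> N}) :
  stable_class f = stable_class g <-> forall x, torsion x -> f x = g x.
Proof.
split=> [/stable_classP fg x tx|fg].
  by apply/eqP; rewrite -subr_eq0; apply/eqP; exact: (torsion_null fg tx).
have [r [rt _ rid]] := torsion_projection M.
rewrite -[stable_class f]stable_compm1 -[stable_class g]stable_compm1 -rid !stable_compE.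
by apply: stable_class_eq => x /=; apply: fg.
Qed.

Lemma torsion_class0P M N (f : {linear M -> N}) :
  stable_class f = 0 <-> forall x, torsion x -> f x = 0.
Proof.
rewrite (_ : 0 = stable_class (\0 : {linear M -> N})) ?torsion_classP //.
by apply/esym/stable_class0P; have [] := @null_maps_zmod_closed R M N; move=> /asboolP.
Qed.


Lemma torsion_kernel A B (f : {linear A -> B}) :
  exists K (k : {linear K -> A}), injective k /\
    forall x, (torsion x /\ f x = 0) <-> exists s, k s = x.
Proof.
apply: (@submod_exists R A (fun x => torsion x /\ f x = 0)).
split=> [|a x y [tx fx] [ty fy]].
  by rewrite linear0; split=> //; exact: (submod0 (torsion_submod A)).
split; first exact: (torsion_submod A).2.
by rewrite linearP fx fy scaler0 addr0.
Qed.

Lemma torsion_module A : exists T (t : {linear T -> A}), injective t /\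
    forall x, torsion x <-> exists s, t s = x.
Proof. exact: submod_exists (torsion_submod A). Qed.

Lemma torsion_sub A K (k : {linear K -> A}) (s : K) :
  injective k -> torsion (k s) -> torsion s.
Proof. by move=> injk tks r rt; apply: injk; rewrite linearZ /= linear0 tks. Qed.

(** [C] is the torsion part of [B] modulo the image of the torsion part of [A]; the map [c] first
    projects [B] to its torsion part. *)
Lemma torsion_cokernel A B (f : {linear A -> B}) :
  exists C (c : {linear B -> C}), [/\ forall y, exists2 b, torsion b & c b = y,
    forall b, torsion b -> c b = 0 -> exists2 x, torsion x & f x = b
    & forall x, torsion x -> c (f x) = 0].
Proof.
have subU : submod (fun y => exists2 x, torsion x & f x = y).
  split=> [|a _ _ [x tx <-] [y ty <-]].
    by exists 0; rewrite ?linear0 //; exact: (submod0 (torsion_submod A)).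
  by exists (a *: x + y); rewrite ?linearP //; exact: (torsion_submod A).2.
have [Q [p [surjp pU]]] := quotient_exists subU.
have [r [rt rK _]] := torsion_projection B.
have [C [j [injj jE]]] := submod_exists (submod_im (linear_comp p r)).
have [|c cE] := @factor_inj R C B Q j (linear_comp p r) injj.
  by move=> x; apply/jE; exists x.
exists C, c; split=> [y|b tb cb0|x tx].
- have /jE[b bE] : exists s, j s = j y by exists y.
  by exists (r b); [exact: rt | apply: injj; rewrite cE -bE /= (rK _ (rt b))].
- by apply/pU; have := cE b; rewrite cb0 linear0 /= rK // => <-.
apply: injj; rewrite linear0 cE /= rK; last exact: torsion_linear.
by apply/pU; exists x.
Qed.

Lemma torsion_monic A B (f : {linear A -> B}) :
  Defs.monic (stable_class f : @Defs.hom (stable_category R) A B) ->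
  forall x, torsion x -> f x = 0 -> x = 0.
Proof.
move=> monf x tx fx; have [K [k [injk kE]]] := torsion_kernel f.
have /torsion_class0P k0 : stable_class k = 0.
  rewrite (_ : 0 = stable_class (\0 : {linear K -> A})); last first.
    by apply/esym/torsion_class0P.
  apply: monf; rewrite /= !stable_compE; apply: stable_class_eq => s /=.
  by rewrite linear0; have /kE[] : exists s', k s' = k s by exists s.
have /kE[s sx] := conj tx fx; rewrite -sx; apply: k0.
by apply: (torsion_sub injk); rewrite sx.
Qed.

Lemma torsion_epic A B (f : {linear A -> B}) :
  Defs.epic (stable_class f : @Defs.hom (stable_category R) A B) ->
  forall b, torsion b -> exists2 x, torsion x & f x = b.
Proof.
move=> epif b tb; have [C [c [_ cker cf]]] := torsion_cokernel f.
have /torsion_class0P c0 : stable_class c = 0.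
  rewrite (_ : 0 = stable_class (\0 : {linear B -> C})); last first.
    by apply/esym/torsion_class0P.
  by apply: epif; rewrite /= !stable_compE; apply/torsion_classP => x tx /=; exact: cf.
by apply: cker => //; exact: c0.
Qed.

Lemma torsion_abelian : abelian (stable_category R).
Proof.
split.
(* A projective module, here R itself, is a zero object. *)
- exists (R^o : lmodType R) => A; split; exists 0; split=> // f _; apply/esym;
    rewrite -[f]stable_class_repr; set g := repr f.
    exact: (@projective_null _ _ R^o _ (linear_id _) g g (@projective_regular R)).
  exact: (@projective_null _ _ R^o _ g (linear_id _) g (@projective_regular R)).
- move=> A0 B0; pose A : lmodType R := A0; pose B : lmodType R := B0.
  have inl_lin : linear (fun x : A => (x, 0 : B)).
    by move=> a x y; apply/pair_equal_spec; rewrite /= scaler0 addr0.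
  have inr_lin : linear (fun y : B => (0 : A, y)).
    by move=> a x y; apply/pair_equal_spec; rewrite /= scaler0 addr0.
  exists ((A * B)%type : lmodType R), (stable_class (linear_of inl_lin)),
    (stable_class (linear_of inr_lin)), (stable_class (fst : {linear (A * B)%type -> A})),
    (stable_class (snd : {linear (A * B)%type -> B})); split; rewrite /= !stable_compE.
  + exact: stable_class_eq.
  + exact: stable_class_eq.
  rewrite -stable_classD; apply: stable_class_eq => -[x y].
  by apply/pair_equal_spec; rewrite /= addr0 add0r.
- move=> A B f; rewrite -[f]stable_class_repr; set g := repr f.
  have [K [k [injk kE]]] := torsion_kernel g.
  exists K, (stable_class k); split=> [|X h].
    rewrite /= stable_compE; apply/torsion_class0P => s _ /=.
    by have /kE[] : exists s', k s' = k s by exists s.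
  rewrite -[h]stable_class_repr /=; set h' := repr h; rewrite stable_compE.
  move=> /torsion_class0P /= gh; have [r [rt rK _]] := torsion_projection X.
  have [|u uE] := @factor_inj R K X A k (linear_comp h' r) injk.
    by move=> x; apply/kE => /=; rewrite gh //; split=> //; exact: torsion_linear.
  exists (stable_class u); split.
    by rewrite stable_compE; apply/torsion_classP => x tx /=; rewrite uE /= rK.
  move=> v; rewrite -[v]stable_class_repr stable_compE => /torsion_classP /= kv.
  by apply/torsion_classP => x tx; apply: injk; rewrite kv // uE /= rK.
- move=> A B f; rewrite -[f]stable_class_repr; set g := repr f.
  have [C [c [surjc cker cg]]] := torsion_cokernel g.
  exists C, (stable_class c); split=> [|X h].
    by rewrite /= stable_compE; apply/torsion_class0P => x tx /=; exact: cg.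
  rewrite -[h]stable_class_repr /=; set h' := repr h; rewrite stable_compE.
  move=> /torsion_class0P /= hg.
  have [T [t [injt tE]]] := torsion_module B.
  have [||u uE] := @factor_surj R C T X (linear_comp c t) (linear_comp h' t).
  + by move=> y; have [b /tE[s <-] <-] := surjc y; exists s.
  + move=> s /= /cker[|x tx <-]; last exact: hg.
    by apply/tE; exists s.
  exists (stable_class u); split.
    rewrite stable_compE; apply/torsion_classP => x /tE[s <-] /=; exact: uE.
  move=> v; rewrite -[v]stable_class_repr stable_compE => /torsion_classP /= vc.
  apply: stable_class_eq => y; have [b tb <-] := surjc y; rewrite vc //.
  by have /tE[s <-] := tb; rewrite [LHS]uE.
(* On torsion parts [g] is injective with image the kernel of [c], so the restriction to torsion of
   a map killed by [c] lifts uniquely through [g]. *)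
- move=> A B f; rewrite -[f]stable_class_repr; set g := repr f => /torsion_monic injg.
  have [C [c [surjc cker cg]]] := torsion_cokernel g.
  exists C, (stable_class c); split=> [|X h].
    by rewrite /= stable_compE; apply/torsion_class0P => x tx /=; exact: cg.
  rewrite -[h]stable_class_repr /=; set h' := repr h; rewrite stable_compE.
  move=> /torsion_class0P /= ch; have [r [rt rK _]] := torsion_projection X.
  have [T [t [injt tE]]] := torsion_module A.
  have [||u uE] := @factor_inj R T X B (linear_comp g t) (linear_comp h' r).
  + apply: linear_inj => s /= gts0; apply: injt; rewrite linear0; apply: injg => //.
    by apply/tE; exists s.
  + move=> x /=; have [||y /tE[s <-] <-] := cker (h' (r x)); last by exists s.
      exact: torsion_linear.
    exact: ch.
  exists (stable_class (linear_comp t u)); split.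
    rewrite stable_compE; apply/torsion_classP => x tx /=.
    by rewrite [LHS]uE /= rK.
  move=> v; rewrite -[v]stable_class_repr stable_compE => /torsion_classP /= gv.
  apply/torsion_classP => x tx; apply/eqP; rewrite -subr_eq0; apply/eqP; apply: injg.
    apply: (submodB (torsion_submod A)); last exact: torsion_linear.
    by apply/tE; exists (u x).
  by rewrite linearB /= gv // [X in X - _]uE /= rK // subrr.
(* Here [g] restricts to a surjection [q] of torsion parts, along which a map vanishing on its
   kernel descends to [u]; preceding [u] by the projection [r0] defines it on all of [B]. *)
- move=> A B f; rewrite -[f]stable_class_repr; set g := repr f => /torsion_epic surjg.
  have [K [k [injk kE]]] := torsion_kernel g.
  exists K, (stable_class k); split=> [|X h].
    rewrite /= stable_compE; apply/torsion_class0P => s _ /=.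
    by have /kE[] : exists s', k s' = k s by exists s.
  rewrite -[h]stable_class_repr /=; set h' := repr h; rewrite stable_compE.
  move=> /torsion_class0P /= hk; have [r [rt rK _]] := torsion_projection B.
  have hker x : torsion x -> g x = 0 -> h' x = 0.
    move=> tx gx; have /kE[s sx] := conj tx gx; rewrite -sx; apply: hk.
    by apply: (torsion_sub injk); rewrite sx.
  have [TA [tA [injtA tAE]]] := torsion_module A.
  have [TB [tB [injtB tBE]]] := torsion_module B.
  have [|q qE] := @factor_inj R TB TA B tB (linear_comp g tA) injtB.
    by move=> s; apply/tBE; apply: (torsion_linear g); apply/tAE; exists s.
  have [||u uE] := @factor_surj R TB TA X q (linear_comp h' tA).
  + move=> y; have /surjg[x /tAE[s <-] sy] : torsion (tB y) by apply/tBE; exists y.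
    by exists s; apply: injtB; rewrite qE.
  + move=> s qs /=; apply: hker; first by apply/tAE; exists s.
    by have := qE s; rewrite qs linear0.
  have [|r0 r0E] := @factor_inj R TB B B tB r injtB; first by move=> b; exact/tBE.
  exists (stable_class (linear_comp u r0)); split.
    rewrite stable_compE; apply/torsion_classP => x /tAE[s <-] /=.
    rewrite -[RHS]uE; congr (u _); apply: injtB; rewrite r0E qE /= rK //.
    by apply: torsion_linear; apply/tAE; exists s.
  move=> v; rewrite -[v]stable_class_repr stable_compE => /torsion_classP /= vg.
  apply/torsion_classP => b tb; have [x tx gx] := surjg b tb.
  have /tAE[s sx] := tx; rewrite -gx vg // -sx -[RHS]uE; congr (u _).
  apply: injtB; rewrite r0E qE /= rK //.
  by rewrite sx; apply: torsion_linear.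
Qed.

End TorsionAbelian.

(** * The torsion theory cogenerated by a family of modules *)

Section TorsionLift.
Variables (R : pzRingType) (tau : seq R).
Implicit Types A B C E K L M N P Q S T W X Y : lmodType R.
Local Notation torsion := (torsion tau).

Variables (I : Type) (V : I -> lmodType R).
Hypothesis V_sub_projective : forall i W (j : {linear W -> V i}), injective j -> projective W.
Hypothesis V_torsion_free : forall i (y : V i), torsion y -> y = 0.
Hypothesis V_faithful : forall a : R, (forall i (y : V i), a *: y = 0) -> a = 0.
Hypothesis V_test : forall A (N : A -> Prop) x r, submod N -> r \in tau -> ~ N (r *: x) ->
  exists i (f : {linear A -> V i}), [/\ forall n, N n -> f n = 0, f (r *: x) <> 0
    & forall a, f (a *: (r *: x)) = 0 -> N (a *: (r *: x))].

(** [V_test] with N = 0 separates a nonzero r x from 0 by a map into some [V i]. Closure of torsion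
    under sums, scalars and extensions is read off from this description. *)
Lemma torsionP A (x : A) : torsion x <-> forall i (f : {linear A -> V i}), f x = 0.
Proof.
split=> [tx i f|fx r rt]; first by apply: V_torsion_free; exact: torsion_linear.
apply: contrapT => rxN0.
have sub0 : submod (fun y : A => y = 0).
  by split=> // a y z -> ->; rewrite scaler0 addr0.
have [i [f [_ frx _]]] := V_test sub0 rt rxN0.
by apply: frx; rewrite linearZ /= fx scaler0.
Qed.

Lemma torsion_submod A : submod (fun x : A => torsion x).
Proof.
split=> [|a x y /torsionP tx /torsionP ty].
  by apply/torsionP => i f; rewrite linear0.
by apply/torsionP => i f; rewrite linearP tx ty scaler0 addr0.
Qed.

Lemma torsion_closed A (x : A) : (forall r, r \in tau -> torsion (r *: x)) -> torsion x.
Proof.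
move=> trx; apply/torsionP => i f; apply: V_torsion_free => r rt.
by rewrite -linearZ; have /torsionP := trx r rt; apply.
Qed.

(** A coordinate in R of a torsion element sends each [V i] to torsion elements, so it acts as 0 and
    vanishes by faithfulness: projective modules are torsion free. *)
Lemma torsion_null A B (f : {linear A -> B}) :
  factors_projective f -> forall x, torsion x -> f x = 0.
Proof.
move=> [P [projP [a [b ->]]]] x tx /=.
have [c /(_ (a x))[s [_ ->]]] := projective_dual_basis projP.
rewrite linear_sum big1 // => t _; rewrite (_ : (c t (a x) : R) = 0) ?scale0r ?linear0 //.
apply: V_faithful => i y; apply: V_torsion_free => r rt; rewrite scalerA.
have <- : c t (a (r *: x)) = r * (c t (a x) : R) by rewrite !linearZ.
by rewrite tx // !linear0 scale0r.
Qed.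

End TorsionLift.

(** Because [tau] is finite, this lets closedness of a domain pass to the union of a chain. *)
Lemma chain_bound (T : Type) (K : eqType) (F : set (set T)) (D : set T -> K -> Prop) (s : seq K) :
    (forall U U' k, U `<=` U' -> D U k -> D U' k) -> (exists U, F U) -> total_on F subset ->
    (forall k, k \in s -> exists2 U, F U & D U k) ->
  exists2 U, F U & forall k, k \in s -> D U k.
Proof.
move=> Dmono [U0 FU0] Ftot; elim: s => [_|k s IHs Fs]; first by exists U0.
have [|U FU DU] := IHs; first by move=> l ls; apply: Fs; rewrite inE ls orbT.
have [|U' FU' DU'] := Fs k; first by rewrite inE eqxx.
have [UU'|U'U] := Ftot _ _ FU FU'.
  exists U' => // l; rewrite inE => /predU1P[-> //|ls]; exact: Dmono UU' (DU l ls).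
exists U => // l; rewrite inE => /predU1P[->|]; [exact: Dmono U'U DU'|exact: DU].
Qed.

(** * Splitting off the torsion part *)

Section TorsionProjection.
Variables (R : pzRingType) (tau : seq R).
Implicit Types A B C E K L M N P Q S T W X Y : lmodType R.
Local Notation torsion := (torsion tau).

Variables (I : Type) (V : I -> lmodType R).
Hypothesis V_sub_projective : forall i W (j : {linear W -> V i}), injective j -> projective W.
Hypothesis V_torsion_free : forall i (y : V i), torsion y -> y = 0.
Hypothesis V_test : forall A (N : A -> Prop) x r, submod N -> r \in tau -> ~ N (r *: x) ->
  exists i (f : {linear A -> V i}), [/\ forall n, N n -> f n = 0, f (r *: x) <> 0
    & forall a, f (a *: (r *: x)) = 0 -> N (a *: (r *: x))].

(* Zorn's lemma on partial lifts whose domain [D] is closed, i.e. [A / D] is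
   torsion free; a closed [D] can be enlarged by a submodule of some [V i],
   which is projective. *)
Lemma torsion_lift A X Y T (t : {linear T -> A}) (g : {linear X -> Y}) (f : {linear A -> Y})
    (h0 : {linear T -> X}) :
    injective t -> (forall x, torsion x <-> exists s, t s = x) ->
    (forall y, exists x, g x = y) -> (forall s, g (h0 s) = f (t s)) ->
  exists h : {linear A -> X}, (forall x, g (h x) = f x) /\ forall s, h (t s) = h0 s.
Proof.
move=> injt tE surjg gh0; have tsub := torsion_submod V_torsion_free V_test.
have tclosed := torsion_closed V_torsion_free V_test.
pose dom (G : set (A * X)) a := exists x, G (a, x).
pose closed (D : A -> Prop) := forall a, (forall r, r \in tau -> D (r *: a)) -> D a.
pose G0 : set (A * X) := [set z | exists2 s, t s = z.1 & h0 s = z.2].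
pose P (G : set (A * X)) := [/\ forall x, G (0, x) -> x = 0,
  forall a x, G (a, x) -> g x = f a & closed (dom G)].
have subG0 : submod G0.
  split=> [|k [x y] [x' y'] [a /= <- <-] [a' /= <- <-]]; first by exists 0; rewrite linear0.
  by exists (k *: a + a'); rewrite linearP.
have PG0 : P G0.
  split=> [x [s /=]|a x [s /= <- <-] //|a ta].
    by rewrite -(linear0 t) => /injt -> <-; rewrite linear0.
  have [|s sa] := (tE a).1; last by exists (h0 s), s.
  by apply: tclosed => r /ta[x [s /= sra _]]; apply/tE; exists s.
have [|G [subG G0G [G1 G2 G3] Gmax]] := submod_zorn subG0 PG0.
  move=> F [U0 FU0] Ftot FP; split=> [x [U FU Ux]|a x [U FU Ux]|a ta].
  - by have [_ [_ [U1 _ _]]] := FP U FU; exact: U1.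
  - by have [_ [_ [_ U2 _]]] := FP U FU; exact: U2.
  have [|||U FU DU] := @chain_bound _ _ F (fun U r => dom U (r *: a)) tau _ _ Ftot.
  - by move=> U U' r UU' [x Ux]; exists x; exact: UU'.
  - by exists U0.
  - by move=> r /ta[x [U FU Ux]]; exists U => //; exists x.
  by have [_ [_ [_ _ /(_ a DU)[x Ux]]]] := FP U FU; exists x, U.
have subD : submod (dom G).
  split=> [|k x y [e Ge] [e' Ge']]; first by exists 0; exact: (submod0 subG).
  by exists (k *: e + e'); exact: (subG.2 k (_, _) (_, _) Ge Ge').
have DT x : dom G x.
  apply: contrapT => nDx.
  have [r [rt nDrx]] : exists r, r \in tau /\ ~ dom G (r *: x).
    apply: contra_notP nDx => nE; apply: G3 => r rt; apply: contrapT => nDr.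
    by apply: nE; exists r.
  have [i [phi [phiD phirx phiM]]] := V_test subD rt nDrx.
  pose M y := exists d (a : R), dom G d /\ y = d + a *: (r *: x).
  have subM : submod M.
    split=> [|k _ _ [d [a [Dd ->]]] [d' [a' [Dd' ->]]]].
      by exists 0, 0; rewrite scale0r addr0; split=> //; exact: submod0.
    exists (k *: d + d'), (k * a + a'); split; first exact: subD.2.
    by rewrite scalerDr addrACA scalerDl -(scalerA k).
  have [Q [p [surjp pM]]] := quotient_exists subM.
  (* [S] is the closure of M = D + R r x, that is, the elements that are torsion modulo [M]. *)
  have [S [j [injj jE]]] : exists S (j : {linear S -> A}), injective j /\
      forall y, torsion (p y) <-> exists s, j s = y.
    apply: (@submod_exists R A (fun y => torsion (p y))).
    split=> [|k y z ty tz]; first by rewrite linear0; exact: (tsub Q).1.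
    by rewrite linearP; apply: (tsub Q).2.
  (* On [M] the kernel of [phi] lies in the domain of [G]; since that domain is closed, the same
     holds on the closure [S]. *)
  have phiK y : torsion (p y) -> phi y = 0 -> dom G y.
    move=> ty phiy; apply: G3 => r' r't; have := ty r' r't.
    rewrite -linearZ => /pM[d [a [Dd dE]]].
    rewrite dE; apply: (submodD subD) => //; apply: phiM.
    have : phi (r' *: y) = 0 by rewrite linearZ /= phiy scaler0.
    by rewrite dE linearD /= phiD // add0r.
  (* The image of [S] in [V i] is projective, so [S] is the direct sum of the domain and a copy of
     [W], on which [k] lifts [f]. *)
  have [W [w [injw wE]]] := submod_exists (submod_im (linear_comp phi j)).
  have projW := V_sub_projective injw.
  have [|a aE] := @factor_inj R W S (V i) w (linear_comp phi j) injw.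
    by move=> s; apply/wE; exists s.
  have [|b bE] := projW S W a (linear_id W).
    move=> y; have /wE[s sE] : exists s, w s = w y by exists y.
    by exists s; apply: injw; rewrite aE.
  have [k kE] := projW X Y g (linear_comp f (linear_comp j b)) surjg.
  have phijb y : phi (j (b y)) = w y by have := aE (b y); rewrite bE.
  pose G' : set (A * X) := [set z | exists y, G (z.1 - j (b y), z.2 - k y)].
  apply: nDrx; have [x' G'x'] : dom G' (r *: x).
    have /jE[s sE] : torsion (p (r *: x)).
      suff -> : p (r *: x) = 0 by exact: (tsub Q).1.
      by apply/pM; exists 0, 1; rewrite scale1r add0r; split=> //; exact: submod0.
    have [z Gz] : dom G (r *: x - j (b (a s))).
      apply: phiK; last by rewrite linearB /= phijb aE -sE subrr.
      by apply/jE; exists (s - b (a s)); rewrite linearB /= sE.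
    by exists (z + k (a s)), (a s); rewrite /= addrK.
  exists x'; apply: (Gmax G') => //.
  - split=> [|c [y z] [y' z'] [u Gu] [u' Gu']].
      by exists 0; rewrite !linear0 ?subr0 ?addr0; exact: (submod0 subG).
    have : G (c *: (y - j (b u)) + (y' - j (b u')), c *: (z - k u) + (z' - k u')).
      exact: subG.2 c _ _ Gu Gu'.
    exists (c *: u + u'); rewrite /= (linearP b) (linearP j) (linearP k) !opprD.
    by rewrite (addrACA (c *: y)) (addrACA (c *: z)) -!scalerBr.
  - by move=> [y z] Gyz; exists 0; rewrite /= !linear0 ?subr0 ?addr0.
  split=> [z [u /= Gu]|y z [u /= Gu]|y yD'].
  - have u0 : u = 0.
      have /phiD : dom G (0 - j (b u)) by exists (z - k u).
      by rewrite sub0r linearN /= phijb => /eqP; rewrite oppr_eq0 -(linear0 w) => /eqP/injw.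
    by move: Gu; rewrite u0 !linear0 ?subr0 ?addr0; exact: G1.
  - have /= := G2 _ _ Gu; rewrite !linearB /= kE /= => /eqP.
    by rewrite subr_eq addrNK => /eqP.
  have /jE[s sE] : torsion (p y).
    apply: tclosed => r' /yD'[z [u /= Gu]]; rewrite -linearZ.
    have -> : r' *: y = (r' *: y - j (b u)) + j (b u) by rewrite subrK.
    rewrite linearD; apply: (submodD (tsub Q)); last by apply/jE; exists (b u).
    suff -> : p (r' *: y - j (b u)) = 0 by exact: (tsub Q).1.
    apply/pM; exists (r' *: y - j (b u)), 0; rewrite scale0r addr0.
    by split=> //; exists (z - k u).
  have [z Gz] : dom G (y - j (b (a s))).
    apply: phiK; last by rewrite linearB /= phijb aE -sE subrr.
    by apply/jE; exists (s - b (a s)); rewrite linearB /= sE.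
  by exists (z + k (a s)), (a s); rewrite /= addrK.
have [|//|//|h hE] := @graph_linear R A X (fun a x => G (a, x)).
  by split=> [|c [x y] [x' y'] /= Gx Gy]; [exact: (submod0 subG) | exact: (subG.2 c _ _ Gx Gy)].
exists h; split=> [x|s]; first exact: G2.
apply/eqP; rewrite -subr_eq0; apply/eqP/G1.
have Gs : G (t s, h0 s) by apply: G0G; exists s.
by have := submodB subG (hE (t s)) Gs; rewrite /= [(_, _) - _](_ : _ = (0, h (t s) - h0 s)) //;
  apply/pair_equal_spec; rewrite /= subrr.
Qed.

Lemma torsion_projection M : exists r : {linear M -> M},
  [/\ forall x, torsion (r x), forall x, torsion x -> r x = x
    & stable_class r = stable_class (linear_id M)].
Proof.
have tsub := torsion_submod V_torsion_free V_test.
have [T [t [injt tE]]] := submod_exists (tsub M).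
(* With target 0 the lifting problem only asks for an extension of the identity of [T] to [M]. *)
have [||h [_ hE]] := @torsion_lift M T 'rV[R]_0 T t \0 \0 (linear_id T) injt tE.
- by move=> y; exists 0; rewrite /= (thinmx0 y).
- by [].
pose r : {linear M -> M} := t \o h.
have rK x : torsion x -> r x = x by move=> /tE[s <-] /=; rewrite hE.
exists r; split=> //; first by move=> x; apply/tE; exists (h x).
pose q : {linear M -> M} := idfun \- r.
have [W [j [injj jE]]] := submod_exists (submod_im q).
have [|a aE] := @factor_inj R W M M j q injj; first by move=> x; apply/jE; exists x.
have aj s : a (j s) = s.
  apply: injj; rewrite aE /=.
  have /jE[x <-] : exists s', j s' = j s by exists s.
  by rewrite /= linearB /= hE subrr linear0 subr0.
have at0 s : a (t s) = 0 by apply: injj; rewrite aE /= hE subrr linear0.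
(* A map on the complement [W] becomes a map on [M] vanishing on [T], so [torsion_lift] applies with
   the zero lift on [T]. *)
have projW : projective W.
  move=> X Y g f surjg.
  have [|k [kE _]] := @torsion_lift M X Y T t g (linear_comp f a) \0 injt tE surjg.
    by move=> s /=; rewrite at0 !linear0.
  by exists (linear_comp k j) => s; rewrite /= kE /= aj.
apply/stable_classP/stable_class0P.
by apply: (projective_null (a := a) (b := \- j) projW) => x /=; rewrite aE /= opprB.
Qed.

End TorsionProjection.

(** * Modules over blocked triangular rings *)

Section ActionModule.
Variables (R D : pzRingType) (V : lmodType D).

(* [rho] is recorded in the type so that the instances below can find it. *)
Definition action_module (rho : {rmorphism R -> lend V}) : Type := V.

Variable rho : {rmorphism R -> lend V}.
HB.instance Definition _ := GRing.Zmodule.on (action_module rho).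

Definition action_scale (a : R) (v : action_module rho) : action_module rho :=
  (rho a : {linear V -> V}) v.

Lemma action_scaleA a b v : action_scale a (action_scale b v) = action_scale (a * b) v.
Proof. by rewrite /action_scale rmorphM. Qed.
Lemma action_scale1 : left_id 1 action_scale.
Proof. by move=> v; rewrite /action_scale rmorph1. Qed.
Lemma action_scaleDr : right_distributive action_scale +%R.
Proof. by move=> a u v; rewrite /action_scale linearD. Qed.
Lemma action_scaleDl v : {morph action_scale^~ v : a b / a + b}.
Proof. by move=> a b; rewrite /action_scale rmorphD. Qed.

HB.instance Definition _ := GRing.Zmodule_isLmodule.Build R (action_module rho)
  action_scaleA action_scale1 action_scaleDr action_scaleDl.

End ActionModule.

Section DivisionRing.
Variables (D : unitRingType) (divD : division_ring D).

Lemma division_injective (E : lmodType D) : injective_module E.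
Proof.
apply: baer_criterion => S i g inji ess.
have [a [aN0 [s sa]]] := ess 1 (oner_neq0 D); rewrite mulr1 in aN0 sa.
exists ((a^-1 : D) *: g s) => t; rewrite scalerA -linearZ /=; congr (g _).
by apply: inji; rewrite linearZ /= sa -[LHS](mulrVK (divD aN0)).
Qed.

(** The functional is prescribed on B + D w, where v in d w + B has value d. *)
Lemma functional_exists (V : lmodType D) (B : V -> Prop) (w : V) :
  submod B -> ~ B w -> exists f : {linear V -> D^o}, f w = 1 /\ forall b, B b -> f b = 0.
Proof.
move=> subB nBw.
have [||f fE] := @injective_graph D D^o V (fun v d => B (v - (d : D) *: w)) (@division_injective _).
- split=> [|a [v d] [v' d'] /= Bv Bv']; first by rewrite /= scale0r subr0; exact: submod0.
  by have := subB.2 a _ _ Bv Bv'; rewrite scalerBr addrACA -opprD scalerA -scalerDl.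
- move=> d; rewrite sub0r => Bd; apply/eqP/negPn/negP => dN0; apply: nBw.
  have := submodN subB (submodZ subB (d^-1) Bd).
  by rewrite scalerN opprK scalerA mulVr ?scale1r //; exact: divD.
exists f; split; first by apply: fE; rewrite scale1r subrr; exact: submod0.
by move=> b Bb; apply: fE; rewrite scale0r subr0.
Qed.

End DivisionRing.

Section Block.
Import VectorInternalTheory.
Variables (R : pzRingType) (D : unitRingType) (divD : division_ring D).
Variables (V : vectType D) (k : nat) (U : 'I_k.+1 -> submodClosed V).
Hypothesis chainU : subspace_chain U.
Variables (rho : {rmorphism R -> lend V}) (Z : R -> Prop).
Hypothesis rho_stable : forall a, rho a \in stabilizer U.
(* In a product ring [Z] is the kernel of the projections to the other factors. *)
Hypothesis Z_zero : Z 0.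
Hypothesis Z_ideal : forall a b r s, Z r -> Z s -> Z (a * r * b + s).
Hypothesis Z_inj : forall r s, Z r -> Z s -> rho r = rho s -> r = s.
Hypothesis Z_lift : forall f : lend V, f \in stabilizer U -> exists2 r, Z r & rho r = f.

Local Notation act := (action_module rho).

Lemma act_scaleE a (v : act) : a *: v = (rho a : {linear V -> V}) v.
Proof. by []. Qed.

Fact rank1_linear (f : {linear V -> D^o}) (x : V) : linear (fun v => (f v : D) *: x).
Proof. by move=> a u v; rewrite linearP scalerDl scalerA. Qed.
Definition rank1 (f : {linear V -> D^o}) (x : V) : lend V := linear_of (rank1_linear f x).

(** The element of [Z] that acts as [f]; the default 0 is taken when [f] does not preserve the
    chain. *)
Definition section_map (f : lend V) : R := xget 0 [set r | Z r /\ rho r = f].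

Lemma section_mapP f : f \in stabilizer U -> Z (section_map f) /\ rho (section_map f) = f.
Proof.
move=> /Z_lift[r Zr rf]; rewrite /section_map; case: xgetP => [s -> //|/(_ r)].
by case; split.
Qed.

Lemma submod_chain i : submod (fun x : V => x \in U i).
Proof. by have [U0 UZ] := GRing.submodClosedP (U i); split=> // a x y; exact: UZ. Qed.

Section FixedFunctional.
Variable f : {linear V -> D^o}.
Definition rank1_stable (x : V) := rank1 f x \in stabilizer U.

Lemma rank1_stable_submod a (x y : act) :
  rank1_stable x -> rank1_stable y -> rank1_stable (a *: x + y).
Proof.
move=> /asboolP fx /asboolP fy; apply/asboolP => i v Uv.
rewrite /= scalerDr; apply: (submodD (submod_chain i)); last exact: fy.
have /asboolP := rho_stable a; have := fx i v Uv => /=.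
by move=> Ux /(_ i _ Ux); rewrite linearZ.
Qed.

(** Following the rank one map f( ) x by the action of [a] gives f( ) (a x). Thus vectors embed
    R-linearly in R as rank one maps with a fixed functional. *)
Lemma section_rank1 a (x y : act) : rank1_stable x -> rank1_stable y ->
  section_map (rank1 f (a *: x + y)) =
  a * section_map (rank1 f x) + section_map (rank1 f y).
Proof.
move=> fx fy; have [Zx xE] := section_mapP fx; have [Zy yE] := section_mapP fy.
have [Zxy xyE] := section_mapP (rank1_stable_submod a fx fy).
apply: Z_inj => //.
  by rewrite -[_ * section_map _]mulr1; exact: Z_ideal.
rewrite rmorphD rmorphM xE yE xyE; apply: linear_funP => v.
by rewrite /= scalerDr act_scaleE linearZ.
Qed.

End FixedFunctional.

Lemma action_sub_projective (W : lmodType R) (j : {linear W -> act}) :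
  injective j -> projective W.
Proof.
(* Choose [s] with [j s] in as few terms of the chain as possible; every term containing [j s] then
   contains the whole image of [j]. *)
move=> injj; pose lev s := #|[pred i | (j s : V) \in U i]|.
have exn : exists n, `[< exists s, lev s = n >] by exists (lev 0); apply/asboolP; exists 0.
case: (ex_minnP exn) => n /asboolP[s levs] nmin.
have minU y i : (j s : V) \in U i -> (j y : V) \in U i.
  move=> si; apply/negPn/negP => yi.
  suff : (lev y < lev s)%N.
    by rewrite levs ltnNge nmin //; apply/asboolP; exists y.
  apply/proper_card/fintype.properP; split.
    apply/fintype.subsetP => i'; rewrite !inE => yi'.
    have [ii'|i'i] := leqP i i'; last exact: (chainU.1 _ _ (ltnW i'i)).
    by case/negP: yi; exact: (chainU.1 _ _ ii').
  by exists i; rewrite !inE.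
have [js0|/eqP jsN0] := pselect (j s = 0).
  apply: (@projective_retract R R^o W \0 \0 (@projective_regular R)) => y /=.
  apply: injj; rewrite linear0; apply/esym/chainU.2/minU; rewrite js0.
  exact: (submod0 (submod_chain _)).
(* [B] is the largest term not containing [j s], or 0. With a functional [f] that is 1 at [j s] and
   0 on [B], all rank one maps f( ) (j y) preserve the chain; applying them to [s] returns y, so [W]
   is a retract of R. *)
pose B (x : V) := x = 0 \/ exists2 i, (j s : V) \notin U i & x \in U i.
have subB : submod B.
  split=> [|a x y]; first by left.
  move=> [-> By|[i si xi] [->|[i' si' yi']]].
  - by rewrite scaler0 add0r.
  - by right; exists i; rewrite // addr0; exact: (submodZ (submod_chain i)).
  right; have [ii'|i'i] := leqP i i'.
    by exists i => //; apply: (submod_chain i).2 => //; exact: (chainU.1 _ _ ii').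
  by exists i' => //; apply: (submod_chain i').2 => //; exact: (chainU.1 _ _ (ltnW i'i)).
have nBs : ~ B (j s) by move=> [js0|[i /negP]] //; rewrite js0 eqxx in jsN0.
have [f [fs fB]] := functional_exists divD subB nBs.
have fst y : rank1_stable f (j y).
  apply/asboolP => i x xi /=; have [si|si] := boolP ((j s : V) \in U i).
    by apply: (submodZ (submod_chain i)); exact: minU.
  by rewrite fB ?scale0r ?(submod0 (submod_chain i)) //; right; exists i.
have alin : linear (fun y => section_map (rank1 f (j y)) : R^o).
  by move=> a y z; rewrite linearP section_rank1.
have blin : linear (fun r : R^o => (r : R) *: s).
  by move=> a y z; rewrite scalerDl -scalerA.
apply: (@projective_retract R R^o W (linear_of alin) (linear_of blin) (@projective_regular R)).
move=> y /=; apply: injj; rewrite linearZ /= act_scaleE (section_mapP (fst y)).2.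
by rewrite /= fs scale1r.
Qed.

Definition coordf (l : 'I_(dim V)) (v : V) : D^o := v2r v 0 l.
Fact coordf_linear l : linear (coordf l).
Proof. by move=> a u v; rewrite /coordf linearP !mxE. Qed.
Definition coordinate l : {linear V -> D^o} := linear_of (coordf_linear l).
Definition basis_vector (l : 'I_(dim V)) : V := r2v (delta_mx 0 l).

Lemma coordinate_sum v : v = \sum_l (coordinate l v : D) *: basis_vector l.
Proof.
rewrite -{1}[v]v2rK [v2r v]row_sum_delta linear_sum.
by apply: eq_bigr => l _; rewrite linearZ.
Qed.

Lemma coordinate_inj v w : (forall l, coordinate l v = coordinate l w) -> v = w.
Proof.
by move=> vw; rewrite (coordinate_sum v) (coordinate_sum w); apply: eq_bigr => l _; rewrite vw.
Qed.

Lemma action_basis_faithful a :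
  (forall l, a *: (basis_vector l : act) = 0) -> forall v : act, a *: v = 0.
Proof.
move=> ab v; rewrite (coordinate_sum v) act_scaleE linear_sum big1 // => l _.
by rewrite linearZ /= -act_scaleE ab scaler0.
Qed.

(* The last nonzero term of the chain, or [V] if all terms are zero; it is a
   simple module over the ring. *)
Definition bottom (x : V) := forall i, (exists2 y, y \in U i & y != 0) -> x \in U i.

Lemma bottom_stable f x : bottom x -> rank1_stable f x.
Proof.
move=> Mx; apply/asboolP => i v vi /=.
have [->|vN0] := eqVneq v 0; first by rewrite linear0 scale0r (submod0 (submod_chain i)).
by apply: (submodZ (submod_chain i)); apply: Mx; exists v.
Qed.

Lemma bottom_submod : @submod R act bottom.
Proof.
split=> [i _|a x y Mx My i Ui]; first exact: (submod0 (submod_chain i)).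
apply: (submodD (submod_chain i)); last exact: My.
by have /asboolP := rho_stable a; apply; exact: Mx.
Qed.

Lemma bottom_exists (x : V) : x != 0 -> exists2 u : V, bottom u & u != 0.
Proof.
move=> xN0; pose P n := `[< exists i : 'I_k.+1, i = n :> nat /\ exists2 y, y \in U i & y != 0 >].
have [nP|exP] := pselect (forall n, ~ P n).
  exists x => // i Ui; have := nP i; case; apply/asboolP; by exists i.
have {}exP : exists n, P n by apply: contra_notP exP => nE n Pn; apply: nE; exists n.
have Pmax n : P n -> (n <= k)%N by move=> /asboolP[i [<- _]]; rewrite -ltnS.
case: (ex_maxnP exP Pmax) => n /asboolP[i [<- [u ui uN0]]] imax.
exists u => // i' [y yi' yN0]; apply: (chainU.1 i' i) => //.
by apply: imax; apply/asboolP; exists i'; split=> //; exists y.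
Qed.

Lemma functional1 (x : V) : x != 0 -> exists f : {linear V -> D^o}, f x = 1.
Proof.
move=> /eqP xN0; have sub0 : submod (fun y : V => y = 0).
  by split=> // a y z -> ->; rewrite scaler0 addr0.
by have [f [fx _]] := functional_exists divD sub0 xN0; exists f.
Qed.

Lemma section_rank10 f : section_map (rank1 f 0) = 0.
Proof.
have st := @bottom_stable f _ (submod0 bottom_submod).
have := section_rank1 1 st st; rewrite scaler0 addr0 mul1r.
by move=> /(congr1 (fun z => z - section_map (rank1 f 0))); rewrite subrr addrK.
Qed.

Lemma section_bottom f a (x : act) : bottom x ->
  section_map (rank1 f (a *: x)) = a * section_map (rank1 f x).
Proof.
move=> Mx; have M0 := submod0 bottom_submod; have st := @bottom_stable f.
have s0 := section_rank10 f.
by have := section_rank1 a (st x Mx) (st 0 M0); rewrite addr0 s0 addr0.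
Qed.

Lemma section_scale f x (v : act) : bottom x ->
  section_map (rank1 f x) *: v = (f v : D) *: x.
Proof.
by move=> Mx; rewrite act_scaleE (section_mapP (bottom_stable f Mx)).2.
Qed.

Lemma bottom_simple (x u : act) : bottom x -> bottom u -> x != 0 -> exists a : R, u = a *: x.
Proof.
move=> Mx Mu xN0; have [f fx] := functional1 xN0.
by exists (section_map (rank1 f u)); rewrite section_scale // fx scale1r.
Qed.

Section Bottom.
Variables (u : V) (Mu : bottom u) (uN0 : u != 0).

Local Notation tau f := (section_map (rank1 f u)).

Lemma action_injective : @injective_module R act.
Proof.
apply: baer_criterion => S i g inji ess.
have [f0 f0u] := functional1 uN0.
(* The ideal contains every rank one map f( ) u: by essentiality it contains some nonzero f( ) (a
   u), and simplicity of the bottom recovers [u] from a u. *)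
have exs f : exists s, i s = tau f.
  have [->|tN0] := eqVneq (tau f) 0; first by exists 0; rewrite linear0.
  have [a [atN0 [s sE]]] := ess _ tN0; rewrite -(section_bottom f a Mu) in atN0 sE.
  have auN0 : a *: (u : act) != 0.
    by apply: contra_neq atN0 => ->; exact: section_rank10.
  have Mau : bottom (a *: (u : act)) by exact: (submodZ bottom_submod).
  have [b uE] := bottom_simple Mau Mu auN0.
  exists (b *: s); rewrite linearZ /= sE {2}uE.
  by rewrite (section_bottom f b Mau).
have [s sE] := choice exs.
(* If [g] is multiplication by [v], it sends f( ) u to (f v) u; since f0 u = 1, the coordinates of
   [v] can be read off. *)
pose v : V := \sum_l (f0 (g (s (coordinate l))) : D) *: basis_vector l.
exists v => t; apply: coordinate_inj => m.
set a : R := i t; pose d l : D := coordinate m (a *: (basis_vector l : act) : act).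
have Mdu l : bottom (d l *: u) by move=> j Uj; apply: (submodZ (submod_chain j)); exact: Mu.
pose kap l := section_map (rank1 f0 (d l *: u)).
(* This expresses the [m]-th coordinate of [a] applied to a vector through row [m] of the matrix of
   [a], whose entries are the [d l]. *)
have tE : tau (coordinate m) *: t = \sum_l kap l *: s (coordinate l).
  apply: inji; rewrite linearZ linear_sum /=.
  under eq_bigr do rewrite linearZ /= sE.
  have Ztau f : Z (tau f) := (section_mapP (bottom_stable f Mu)).1.
  apply: Z_inj.
  - by have := Z_ideal 1 a (Ztau (coordinate m)) Z_zero; rewrite mul1r addr0.
  - elim/big_ind: _ => [//|b c Zb Zc|l _].
      by have := Z_ideal 1 1 Zb Zc; rewrite mul1r mulr1.
    by have := Z_ideal (kap l) 1 (Ztau (coordinate l)) Z_zero; rewrite mulr1 addr0.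
  apply: linear_funP => x; rewrite -[LHS]act_scaleE -[RHS]act_scaleE -scalerA.
  rewrite section_scale // scaler_suml {1}(coordinate_sum x) act_scaleE !linear_sum scaler_suml.
  apply: eq_bigr => l _; rewrite -scalerA !section_scale // !linearZ /= f0u.
  by rewrite [_ *: (1 : D^o)]mulr1 scalerA.
have := congr1 g tE; rewrite linearZ /= section_scale // linear_sum /=.
under eq_bigr do rewrite linearZ /= section_scale // scalerA.
rewrite -scaler_suml => /(congr1 f0); rewrite !linearZ /= f0u.
rewrite [_ *: (1 : D^o)]mulr1 [RHS]mulr1 => ->.
rewrite /v act_scaleE !linear_sum.
rewrite -[coordf m _]/(coordinate m _) linear_sum; apply: eq_bigr => l _.
by rewrite !linearZ.
Qed.

(** On [N] plus the elements (f( ) w) x, with [w] in the bottom, send the latter to [w] and [N] to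
    0. Simplicity of the bottom makes this well defined, and injectivity extends it. *)
Lemma action_test (A : lmodType R) (N : A -> Prop) (x : A) f : submod N -> ~ N (tau f *: x) ->
  exists h : {linear A -> act}, [/\ forall n, N n -> h n = 0, h (tau f *: x) <> 0
    & forall a, h (a *: (tau f *: x)) = 0 -> N (a *: (tau f *: x))].
Proof.
move=> subN nNx.
pose G (y : A) (w : act) := bottom w /\ N (y - section_map (rank1 f w) *: x).
have [||h hE] := injective_graph action_injective (G := G).
- split=> [|a [y w] [y' w'] [/= Mw Nw] [/= Mw' Nw']].
    split; first exact: (submod0 bottom_submod).
    by rewrite section_rank10 scale0r subr0; exact: submod0.
  split; first exact: bottom_submod.2.
  rewrite section_rank1; try exact: bottom_stable.
  have := subN.2 a _ _ Nw Nw'.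
  by rewrite scalerBr addrACA -opprD scalerA -scalerDl.
- move=> w [Mw]; rewrite sub0r => /(submodN subN); rewrite opprK => Nw.
  apply: contrapT => /eqP wN0; apply: nNx; have [b ->] := bottom_simple Mw Mu wN0.
  by rewrite section_bottom // -scalerA; exact: submodZ.
have htau : h (tau f *: x) = u.
  by apply: hE; split=> //; rewrite subrr; exact: (submod0 subN).
exists h; split=> [n Nn||a].
- apply: hE; split; first exact: (submod0 bottom_submod).
  by rewrite section_rank10 scale0r subr0.
- by rewrite htau; apply/eqP.
rewrite linearZ /= htau => au0; rewrite scalerA -section_bottom // au0.
by rewrite section_rank10 scale0r; exact: submod0.
Qed.

Lemma action_torsion_free (y : act) : (forall l, tau (coordinate l) *: y = 0) -> y = 0.
Proof.
move=> ty; apply: coordinate_inj => l; rewrite linear0.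
have := ty l; rewrite section_scale //; have [f fu] := functional1 uN0.
by move=> /(congr1 f); rewrite linearZ /= fu linear0 [_ *: _]mulr1.
Qed.

End Bottom.

End Block.

(** * Rings acting faithfully on a finite family of vectors *)

Section FiniteFamilies.
Variable R : pzRingType.
Implicit Types A B C E K L M N P Q S T W X Y : lmodType R.
Variables (J : eqType) (V : J -> lmodType R) (v : forall l, V l).

(** Induction on [s]: the image of x |-> x v l is a submodule of [V l], hence projective, and splits
    off; the kernel is handled by the remaining vectors. *)
Lemma projective_of_family (s : seq J) X (i : {linear X -> R^o}) :
    (forall l W (j : {linear W -> V l}), injective j -> projective W) ->
    (forall x, (forall l, l \in s -> (i x : R) *: v l = 0) -> x = 0) -> projective X.
Proof.
move=> subP; elim: s X i => [|l s IHs] X i ix.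
  apply: (@projective_retract R R^o X \0 \0 (@projective_regular R)) => x.
  by rewrite [x]ix //= linear0.
have flin : linear (fun x => (i x : R) *: v l).
  by move=> a x y; rewrite linearP scalerDl -scalerA.
pose f : {linear X -> V l} := linear_of flin.
have [W [j [injj jE]]] := submod_exists (submod_im f).
have projW := subP l W j injj.
have [|a aE] := @factor_inj R W X (V l) j f injj; first by move=> x; apply/jE; exists x.
have [|b bE] := projW X W a (linear_id W).
  move=> w; have /jE[x xE] : exists s, j s = j w by exists w.
  by exists x; apply: injj; rewrite aE.
have [K [k [injk kE]]] := submod_exists (submod_ker f).
have projK : projective K.
  apply: (IHs K (linear_comp i k)) => x sx; apply: injk; rewrite linear0; apply: ix => l'.
  by rewrite inE => /predU1P[->|/sx //]; apply/kE; exists x.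
pose q : {linear X -> X} := idfun \- (b \o a).
have [|c cE] := @factor_inj R K X X k q injk.
  move=> x; apply/kE; rewrite [f _](_ : _ = f (x - b (a x))) // linearB -2!aE bE.
  exact: subrr.
have hlin : linear (fun x => (c x, a x) : K * W).
  by move=> t x y; apply/pair_equal_spec; rewrite !linearP.
apply: (@projective_retract R (K * W)%type X (linear_of hlin) ((k \o fst) \+ (b \o snd))).
  exact: projective_pair.
by move=> x /=; rewrite cE /= subrK.
Qed.

Lemma injective_pair E E' : injective_module E -> injective_module E' ->
  injective_module (E * E')%type.
Proof.
move=> injE injE' A B i f inji.
have [h hE] := injE A B i (fst \o f) inji; have [h' h'E] := injE' A B i (snd \o f) inji.
have klin : linear (fun x => (h x, h' x) : E * E').
  by move=> t x y; apply/pair_equal_spec; rewrite !linearP.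
by exists (linear_of klin) => x /=; rewrite hE h'E /=; case: (f x).
Qed.

Lemma injective_rV0 : injective_module 'rV[R]_0.
Proof. by move=> A B i f _; exists \0 => x; rewrite [RHS]thinmx0. Qed.

Lemma embed_family (s : seq J) :
    (forall l, projective (V l)) -> (forall l, injective_module (V l)) ->
  exists X (f : {linear R^o -> X}), [/\ projective X, injective_module X
    & forall a, f a = 0 -> forall l, l \in s -> (a : R) *: v l = 0].
Proof.
move=> projV injV; elim: s => [|l s [X [f [projX injX fE]]]].
  by exists 'rV[R]_0, \0; split; [exact: projective_rV0 | exact: injective_rV0 |].
have glin : linear (fun a : R^o => (f a, (a : R) *: v l) : X * V l).
  move=> t x y; apply/pair_equal_spec; rewrite linearP; split=> //=.
  by rewrite scalerDl -scalerA.
exists (X * V l)%type, (linear_of glin); split.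
- exact: projective_pair.
- exact: injective_pair.
move=> a /pair_equal_spec[/fE fa vl] l'.
by rewrite inE => /predU1P[->|/fa].
Qed.

End FiniteFamilies.

(** Bundled so that [choice] can pick a whole family of blocks. *)
Record block := Block {
  block_ring : unitRingType;
  block_space : vectType block_ring;
  block_length : nat;
  block_chain : 'I_block_length.+1 -> submodClosed block_space;
  block_division : division_ring block_ring;
  block_chainP : subspace_chain block_chain
}.

(** * Finite products of blocked triangular rings *)

Section Blocks.
Variables (R : pzRingType) (n : nat) (b : 'I_n -> block).
Variable p : forall i, {rmorphism R -> stabilizer_ring (@block_chain (b i))}.
Hypothesis p_bij : bijective (fun r i => p i r).

Let rho i : {rmorphism R -> lend (block_space (b i))} :=
  (\val : {rmorphism stabilizer_ring (@block_chain (b i)) -> lend (block_space (b i))}) \o p i.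
Let V i : lmodType R := action_module (rho i).
Let Z i (r : R) := forall j, j != i -> p j r = 0.

Lemma block_projections_inj r s : (forall i, p i r = p i s) -> r = s.
Proof. by move=> rs; apply: (bij_inj p_bij); apply: functional_extensionality_dep. Qed.

Lemma block_action_stable i a : rho i a \in stabilizer (@block_chain (b i)).
Proof. exact: (valP (p i a)). Qed.

Lemma block_ideal0 i : Z i 0. Proof. by move=> j _; rewrite rmorph0. Qed.
Lemma block_idealP i x y r s : Z i r -> Z i s -> Z i (x * r * y + s).
Proof. by move=> Zr Zs j ji; rewrite rmorphD !rmorphM /= Zr // Zs // mulr0 mul0r addr0. Qed.
Lemma block_ideal_inj i r s : Z i r -> Z i s -> rho i r = rho i s -> r = s.
Proof.
move=> Zr Zs /val_inj rs; apply: block_projections_inj => j.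
by have [->//|ji] := eqVneq j i; rewrite Zr ?Zs.
Qed.
Lemma block_lift i (f : lend (block_space (b i))) : f \in stabilizer (@block_chain (b i)) ->
  exists2 r, Z i r & rho i r = f.
Proof.
move=> fs; have [q qK Kq] := p_bij.
pose g := dfwith (fun j => 0 : stabilizer_ring (@block_chain (b j))) (StabilizerRing fs).
have pq j : p j (q g) = g j by rewrite -{2}(Kq g).
exists (q g) => [j ji|]; first by rewrite pq /g dfwith_out // eq_sym.
by rewrite /= pq /g dfwith_in.
Qed.

Lemma block_sub_projective i (W : lmodType R) (j : {linear W -> V i}) : injective j -> projective W.
Proof.
exact: (action_sub_projective (@block_division _) (@block_chainP _) (@block_action_stable i)
  (@block_idealP i) (@block_ideal_inj i) (@block_lift i)).
Qed.

Lemma block_module_injective i : injective_module (V i).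
Proof.
(* The zero module is treated apart, since the general argument needs a nonzero vector in the
   bottom. *)
have [V0|[x /eqP xN0]] : (forall x : V i, x = 0) \/ exists x : V i, x <> 0.
    have [|V0] := pselect (exists x : V i, x <> 0); first by right.
    by left=> x; apply: contra_notP V0 => xN0; exists x.
  by move=> A B j f _; exists \0 => x; rewrite [RHS]V0.
have [u Mu uN0] := bottom_exists (@block_chainP (b i)) xN0.
exact: (action_injective (@block_division _) (@block_action_stable i) (@block_ideal0 i)
  (@block_idealP i) (@block_ideal_inj i) (@block_lift i) Mu uN0).
Qed.

Lemma block_torsion_test i : exists tau : seq R,
  (forall y : V i, torsion tau y -> y = 0) /\
  forall (A : lmodType R) (N : A -> Prop) x r, submod N -> r \in tau -> ~ N (r *: x) ->
    exists f : {linear A -> V i}, [/\ forall n, N n -> f n = 0, f (r *: x) <> 0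
      & forall a, f (a *: (r *: x)) = 0 -> N (a *: (r *: x))].
Proof.
have [V0|[x /eqP xN0]] : (forall x : V i, x = 0) \/ exists x : V i, x <> 0.
    have [|V0] := pselect (exists x : V i, x <> 0); first by right.
    by left=> x; apply: contra_notP V0 => xN0; exists x.
  by exists [::].
have [u Mu uN0] := bottom_exists (@block_chainP (b i)) xN0.
exists [seq section_map (rho i) (Z i) (rank1 (coordinate l) u) | l : 'I_(dim (block_space (b i)))].
split=> [y ty|A N y r subN /mapP[l _ ->]].
  apply: (action_torsion_free (@block_division _) (@block_lift i) Mu uN0) => l.
  by apply: ty; apply: map_f; rewrite mem_enum.
exact: (action_test (@block_division _) (@block_action_stable i) (@block_ideal0 i)
  (@block_idealP i) (@block_ideal_inj i) (@block_lift i) Mu uN0).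
Qed.

Lemma block_modules_faithful a : (forall i (y : V i), a *: y = 0) -> a = 0.
Proof.
move=> aV; apply: block_projections_inj => i; rewrite rmorph0; apply: val_inj.
by apply: linear_funP => y; exact: (aV i y).
Qed.

Let L : eqType := {i : 'I_n & 'I_(dim (block_space (b i)))}.
Let v (l : L) : V (tag l) := basis_vector (tagged l).

Lemma block_bases_faithful (a : R) : (forall l, l \in enum {: L} -> a *: v l = 0) -> a = 0.
Proof.
move=> av; apply: block_modules_faithful => i; apply: action_basis_faithful => l.
by have := av (Tagged _ l); rewrite mem_enum; apply.
Qed.

Lemma blocks_hereditary : ideals_projective R.
Proof.
move=> S j injj; apply: (projective_of_family (v := v) (s := enum {: L}) (i := j)).
  by move=> l W k; exact: block_sub_projective.
by move=> x /block_bases_faithful jx; apply: injj; rewrite jx linear0.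
Qed.

Lemma blocks_projective_envelope : projective_injective_envelope R.
Proof.
have [||X [f [projX injX fE]]] := embed_family v (enum {: L}).
- by move=> l; apply: (block_sub_projective (j := linear_id _)).
- by move=> l; exact: block_module_injective.
apply: (projective_envelope (i := f)) => //; apply: linear_inj => a /fE.
exact: block_bases_faithful.
Qed.

Lemma blocks_abelian : abelian (stable_category R).
Proof.
have [tau tauP] := choice block_torsion_test; pose t := flatten [seq tau i | i : 'I_n].
have tfree i (y : V i) : torsion t y -> y = 0.
  move=> ty; apply: (tauP i).1 => r rt; apply: ty; apply/flattenP.
  by exists (tau i) => //; apply: map_f; rewrite mem_enum.
have ttest (A : lmodType R) (N : A -> Prop) x r : submod N -> r \in t -> ~ N (r *: x) ->
  exists i (f : {linear A -> V i}), [/\ forall n, N n -> f n = 0, f (r *: x) <> 0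
    & forall a, f (a *: (r *: x)) = 0 -> N (a *: (r *: x))].
  by move=> subN /flattenP[_ /mapP[i _ ->]] rt nN; exists i; exact: (tauP i).2.
apply: (@torsion_abelian R t).
- by move=> M; exact: (torsion_submod tfree ttest).
- by move=> M; exact: (torsion_projection block_sub_projective tfree ttest).
- by move=> M N f; exact: (torsion_null tfree block_modules_faithful).
Qed.

End Blocks.

Lemma product_blocks (R : pzRingType) : finite_product_blocked_triangular R ->
  exists n (b : 'I_n -> block) (p : forall i, {rmorphism R -> stabilizer_ring (@block_chain (b i))}),
    bijective (fun r i => p i r).
Proof.
move=> [n [S [Sblock [p p_bij]]]].
have exb i : exists b : block, ring_isomorphic (S i) (stabilizer_ring (@block_chain b)).
  have [D [divD [V [k [U [chainU iso]]]]]] := Sblock i.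
  by exists (Block divD chainU).
have [b bE] := choice exb.
pose f i := projT1 (cid (bE i)); have f_bij i : bijective (f i) := projT2 (cid (bE i)).
pose q i : {rmorphism R -> stabilizer_ring (@block_chain (b i))} := f i \o p i.
exists n, b, q; have [g gp pg] := p_bij.
have exh i : exists h, cancel (f i) h /\ cancel h (f i).
  by have [h fh hf] := f_bij i; exists h.
pose h i := projT1 (cid (exh i)).
have hf i : cancel (f i) (h i) /\ cancel (h i) (f i) := projT2 (cid (exh i)).
exists (fun s => g (fun i => h i (s i))) => [r|s] /=.
  by rewrite -[RHS]gp; congr (g _); apply: functional_extensionality_dep => i; rewrite (hf i).1.
apply: functional_extensionality_dep => i.
by have /= -> := congr1 (@^~ i) (pg (fun i => h i (s i))); rewrite (hf i).2.
Qed.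

Theorem product_blocks_sufficient (R : pzRingType) : finite_product_blocked_triangular R ->
  [/\ left_hereditary R, projective_injective_envelope R & abelian (stable_category R)].
Proof.
move=> /product_blocks[n [b [p p_bij]]]; split.
- by apply/left_hereditaryP; exact: blocks_hereditary p_bij.
- exact: blocks_projective_envelope p_bij.
- exact: blocks_abelian p_bij.
Qed.

(** * Projective injective envelopes *)

Section FiniteGeneration.
Variables (R : pzRingType) (hR : ideals_projective R).
Variables (E : lmodType R) (i : {linear R^o -> E}).
Hypothesis injE : injective_module E.
Hypothesis projE : projective E.
Hypothesis essi : essential_sub (fun x => exists a, i a = x).

(* The dual basis elements supporting [i 1] already span [E], since two
   endomorphisms of [E] that agree on [i R] are equal. *)
Lemma envelope_finite_basis : exists (s : seq E) (c : E -> {linear E -> R^o}),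
  forall x, x = \sum_(t <- s) (c t x : R) *: t.
Proof.
have [c cE] := projective_dual_basis projE; have [s [_ sE]] := cE (i 1).
exists s, c; have glin : linear (fun x => \sum_(t <- s) (c t x : R) *: t).
  move=> a x y; rewrite scaler_sumr -big_split; apply: eq_bigr => t _ /=.
  by rewrite linearP scalerDl -scalerA.
apply: (essential_eq hR (f := linear_id E) (g := linear_of glin) projE essi) => _ [a <-] /=.
have iE : i a = (a : R) *: i 1 by rewrite -linearZ /=; congr (i _); rewrite [RHS]mulr1.
rewrite iE {1}sE scaler_sumr; apply: eq_bigr => t _.
by rewrite linearZ /= scalerA.
Qed.

Section Orthogonal.
Variable a : nat * nat -> {linear E -> E}.
Hypothesis a_id : forall n x, a n (a n x) = a n x.
Hypothesis a_orth : forall m n x, m != n -> a m (a n x) = 0.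
Local Notation K := (nat * nat)%type.

Let N0 x := exists s : seq K, x = \sum_(n <- undup s) a n x.

Let N0_widen x (s t : seq K) :
  {subset s <= t} -> x = \sum_(n <- undup s) a n x -> x = \sum_(n <- undup t) a n x.
Proof.
move=> st xE; rewrite (bigID (mem s)) /= [X in _ + X]big1 => [|n /negP ns].
  rewrite addr0 -big_filter {1}xE; apply: perm_big; apply: uniq_perm.
  - exact: undup_uniq.
  - exact/filter_uniq/undup_uniq.
  by move=> n; rewrite mem_filter !mem_undup; case: (boolP (n \in s)) => // /st ->.
rewrite xE linear_sum big_seq big1 // => m; rewrite mem_undup => ms.
by apply: a_orth; apply: contra_notN ns => /eqP ->.
Qed.

Let N0_sub : submod N0.
Proof.
split=> [|k x y [s xE] [t yE]]; first by exists [::]; rewrite big_nil.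
have {}xE : x = \sum_(n <- undup (s ++ t)) a n x.
  by apply: N0_widen xE => n ns; rewrite mem_cat ns.
have {}yE : y = \sum_(n <- undup (s ++ t)) a n y.
  by apply: N0_widen yE => n nt; rewrite mem_cat nt orbT.
exists (s ++ t); under eq_bigr do rewrite linearP.
by rewrite big_split /= -scaler_sumr -xE -yE.
Qed.

Let N0_a n x : N0 (a n x).
Proof. by exists [:: n]; rewrite big_seq1 a_id. Qed.

Let N0_eq0 x : N0 x -> (forall n, a n x = 0) -> x = 0.
Proof. by move=> [s xE] ax; rewrite xE big1. Qed.

(* [eps A] is an idempotent endomorphism onto the closure of the sum of the images
   of the [a n] with [A n]; closures are unique since [E] is projective. *)
Lemma partial_projections : exists eps : set K -> {linear E -> E},
  [/\ forall (A : set K) n x, A n -> eps A (a n x) = a n x,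
      forall (A : set K) n x, ~ A n -> a n (eps A x) = 0
    & forall (A B : set K) x, A `<=` B -> eps B (eps A x) = eps A x].
Proof.
have [C [subC NC Cmax]] := complement_exists N0_sub.
pose U x := exists x0 c, [/\ N0 x0, C c & x = x0 + c].
have essU : essential_sub U.
  move=> x xN0; have [Cx|nCx] := pselect (C x).
    exists 1; rewrite scale1r; split=> //; exists 0, x; rewrite add0r; split=> //.
    exact: submod0 N0_sub.
  have [t [h [c [Nh Cc hN0 E0]]]] := complement_essential N0_sub subC Cmax nCx.
  exists t; split; last by exists h, c.
  rewrite E0; apply: contra_neq hN0 => /eqP; rewrite addr_eq0 => /eqP hc.
  by apply: NC => //; rewrite hc; exact: (submodN subC).
have eqU (f g : {linear E -> E}) : (forall n x, f (a n x) = g (a n x)) ->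
    (forall c, C c -> f c = g c) -> forall x, f x = g x.
  move=> fga fgC; apply: (essential_eq hR projE essU) => _ [x0 [c [[s x0E] Cc ->]]].
  rewrite !linearD (fgC c) //; congr (_ + _); rewrite x0E !linear_sum.
  by apply: eq_bigr => n _; exact: fga.
(* On the essential submodule N0 + C, [eps A] keeps the components with index in [A] and kills the
   other components and [C]. *)
pose G (A : set K) (x y : E) := exists x0 c, [/\ [/\ N0 x0, C c & x = x0 + c], N0 y,
  forall n, A n -> a n y = a n x0 & forall n, ~ A n -> a n y = 0].
have epsE (A : set K) : exists e : {linear E -> E}, forall x y, G A x y -> e x = y.
  apply: injective_graph => //.
    split=> [|k [x y] [x' y'] [x0 [c [[Nx Cc /= ->] Ny Ay nAy]]]].
      exists 0, 0; rewrite addr0; split; last by move=> n _; rewrite linear0.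
      - by split=> //; [exact: submod0 N0_sub | exact: submod0].
      - exact: submod0 N0_sub.
      - by [].
    move=> [x0' [c' [[Nx' Cc' /= ->] Ny' Ay' nAy']]].
    exists (k *: x0 + x0'), (k *: c + c'); split=> [|||n nAn].
    - split; [exact: N0_sub.2 | exact: subC.2 |].
      by rewrite scalerDr addrACA.
    - exact: N0_sub.2.
    - by move=> n An; rewrite !linearP Ay // Ay'.
    - by rewrite linearP nAy // nAy' // scaler0 addr0.
  move=> y [x0 [c [[Nx Cc /esym/eqP xc] Ny Ay nAy]]].
  have x00 : x0 = 0.
    by apply: NC => //; move: xc; rewrite addr_eq0 => /eqP ->; exact: submodN.
  apply: N0_eq0 => // n; have [An|/nAy //] := pselect (A n).
  by rewrite Ay // x00 linear0.
have [eps {}epsE] := choice epsE.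
have epsa A n x : A n -> eps A (a n x) = a n x.
  move=> An; apply: epsE; exists (a n x), 0; rewrite addr0; split=> //.
    by split=> //; exact: submod0.
  by move=> m nAm; apply: a_orth; apply: contra_notN nAm => /eqP ->.
have epsa0 A n x : ~ A n -> eps A (a n x) = 0.
  move=> nAn; apply: epsE; exists (a n x), 0; rewrite addr0; split=> //.
  - by split=> //; exact: submod0.
  - exact: submod0 N0_sub.
  - by move=> m Am; rewrite linear0 a_orth //; apply: contra_notN nAn => /eqP <-.
  by move=> m _; rewrite linear0.
have epsC A c : C c -> eps A c = 0.
  move=> Cc; apply: epsE; exists 0, c; rewrite add0r; split=> //.
  - by split=> //; exact: submod0 N0_sub.
  - exact: submod0 N0_sub.
  by move=> m _; rewrite linear0.
exists eps; split=> // [A n x nAn|A B x AB].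
  apply: (eqU (linear_comp (a n) (eps A)) \0) => [m y|c Cc] /=; last first.
    by rewrite (epsC A) // linear0.
  have [Am|nAm] := pselect (A m); last by rewrite epsa0 // linear0.
  by rewrite epsa // a_orth //; apply: contra_notN nAn => /eqP ->.
apply: (eqU (linear_comp (eps B) (eps A)) (eps A)) => [m y|c Cc] /=; last first.
  by rewrite (epsC A) // linear0.
have [Am|nAm] := pselect (A m); last by rewrite (epsa0 A) // linear0.
by rewrite epsa // epsa //; exact: AB.
Qed.

(* Let [J] be the union of the images of [eps A] for the sets [A] with finite
   columns. Each image is finitely generated, so it has finite support in a dual
   basis of the projective module [J]; a whole column does not. A diagonal choice
   of one element in each column then gives a set [A] of infinite support. *)
Lemma no_orthogonal_pairs : ~ (forall n, exists x, a n x != 0).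
Proof.
move=> aN0; have [eps [eps1 eps0 epsS]] := partial_projections.
have [gs [gc gE]] := envelope_finite_basis.
pose finite_columns (A : set K) := forall k, exists m0, forall m, A (k, m) -> (m < m0)%N.
pose J x := exists2 A, finite_columns A & eps A x = x.
have finU (A B : set K) : finite_columns A -> finite_columns B -> finite_columns (A `|` B).
  move=> fA fB k; have [m0 mA] := fA k; have [m1 mB] := fB k.
  exists (maxn m0 m1) => m [/mA|/mB] lt; rewrite leq_max lt ?orbT //.
have fin0 : finite_columns set0 by move=> k; exists 0%N.
have JU A x : eps A x = x -> forall B, A `<=` B -> eps B x = x.
  by move=> Ax B AB; rewrite -{1}Ax epsS.
have subJ : submod J.
  split=> [|k x y [A fA Ax] [B fB By]]; first by exists set0; rewrite ?linear0.
  exists (A `|` B); first exact: finU.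
  by rewrite linearP (JU A x Ax _ (@subsetUl _ _ _)) (JU B y By _ (@subsetUr _ _ _)).
have [S [j [injj jJ]]] := submod_exists subJ.
have [c cE] := projective_dual_basis (projective_sub hR projE injj).
(* The finitely many generators of [E] have images under [eps A] with finite supports, and these
   bound the supports on the whole image. *)
have supp_bounded A : finite_columns A -> exists F : seq S,
    forall z, eps A (j z) = j z -> forall t, t \notin F -> c t z = 0.
  move=> fA; have Jeps x : exists z, j z = eps A x.
    by apply/jJ; exists A => //; exact: epsS.
  have [z zE] := choice Jeps; have [supp suppE] := choice cE.
  exists (flatten [seq supp (z u) | u <- gs]) => y yE t tF.
  have -> : y = \sum_(u <- gs) (gc u (j y) : R) *: z u.
    apply: injj; rewrite -{1}yE {1}(gE (j y)) !linear_sum; apply: eq_bigr => u _.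
    by rewrite !linearZ /= zE.
  rewrite linear_sum big_seq big1 // => u us; rewrite linearZ /= (suppE (z u)).1 ?scaler0 //.
  apply: contra tF => tz; apply/flattenP; exists (supp (z u)) => //; exact: map_f.
(* Otherwise column [k] lies in the span of [F], hence in the image of a single [eps A] with finite
   columns, and this image misses the components of column [k] outside [A]. *)
have escape k (F : seq S) : exists q : nat * S * S,
    [/\ a (k, q.1.1) (j q.1.2) = j q.1.2, q.2 \notin F & c q.2 q.1.2 != 0].
  apply: contrapT => nE.
  have cF m z t : a (k, m) (j z) = j z -> t \notin F -> c t z = 0.
    move=> az tF; apply/eqP/negPn/negP => cN0; apply: nE.
    by exists (m, z, t).
  have [A fA AF] : exists2 A, finite_columns A & forall t, t \in F -> eps A (j t) = j t.
    elim: (F) => [|t s [A fA As]]; first by exists set0.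
    have [B fB Bt] : J (j t) by apply/jJ; exists t.
    exists (A `|` B); first exact: finU.
    move=> t'; rewrite inE => /predU1P[->|/As At'].
      by apply: JU Bt _ _; exact: subsetUr.
    by apply: JU At' _ _; exact: subsetUl.
  have [m0 m0A] := fA k; have [x xN0] := aN0 (k, m0).
  have nA : ~ A (k, m0) by move=> /m0A; rewrite ltnn.
  have [z zE] : exists z, j z = a (k, m0) x.
    apply/jJ; exists [set (k, m0)]; last exact: eps1.
    by move=> k'; exists m0.+1 => m [_ ->].
  have az : a (k, m0) (j z) = j z by rewrite zE a_id.
  have ez : eps A (j z) = j z.
    have [s [_ zs]] := cE z; rewrite zs !linear_sum; apply: eq_bigr => t _.
    rewrite !linearZ /=; have [tF|tF] := boolP (t \in F); first by rewrite AF.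
    by rewrite (cF m0) // !scale0r.
  by move: xN0; rewrite -zE -az -ez eps0 ?eqxx.
have [q qE] := choice (fun kF : nat * seq S => escape kF.1 kF.2).
(* [F n] lists the basis elements used in the columns before [n], so the elements [t n] are pairwise
   distinct. *)
pose fix F n : seq S := if n is n'.+1 then (q (n', F n')).2 :: F n' else [::].
pose t n := (q (n, F n)).2; pose z n := (q (n, F n)).1.2; pose m n := (q (n, F n)).1.1.
have tF n l : (n < l)%N -> t n \in F l.
  elim: l => // l IHl; rewrite ltnS leq_eqVlt => /predU1P[->|/IHl nl] /=; rewrite inE ?eqxx //.
  by rewrite nl orbT.
have t_inj : injective t.
  move=> n l; case: (ltngtP n l) => // lt tnl.
    by have [_ /negP[]] := qE (l, F l); rewrite -/(t l) -tnl; exact: tF.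
  by have [_ /negP[]] := qE (n, F n); rewrite -/(t n) tnl; exact: tF.
pose A : set K := [set p | p.2 = m p.1].
have fA : finite_columns A by move=> k; exists (m k).+1 => l lm; have -> : l = m k := lm.
have [B zB] := supp_bounded A fA.
have tB n : t n \in B.
  have [az _ /eqP cN0] := qE (n, F n); apply: contrapT => /negP /(zB (z n)) c0.
  by apply: cN0; apply: c0; rewrite -[j (z n)]az; exact: eps1.
have := uniq_leq_size (s1 := [seq t n | n <- iota 0 (size B).+1]) (s2 := B).
rewrite map_inj_uniq // iota_uniq size_map size_iota ltnn => /(_ isT) sub.
by suff : false by []; apply: sub => _ /mapP[n _ ->]; exact: tB.
Qed.

End Orthogonal.

Lemma no_orthogonal_sequence (a : nat -> {linear E -> E}) :
    (forall n x, a n (a n x) = a n x) -> (forall m n x, m != n -> a m (a n x) = 0) ->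
  ~ (forall n, exists x, a n x != 0).
Proof.
move=> a_id a_orth aN0.
apply: (@no_orthogonal_pairs (fun p => a (pickle p))) => [n x|m n x mn|n] //.
by apply: a_orth; rewrite (inj_eq (pcan_inj pickleK)).
Qed.

End FiniteGeneration.

(** * Decomposition into indecomposable modules *)

Section NiceModules.
Variables (R : pzRingType) (hR : ideals_projective R).
Implicit Types A B C K L M N P Q S T V W X Y : lmodType R.

Definition indecomposable V :=
  forall q : {linear V -> V}, (forall x, q (q x) = q x) ->
    (forall x, q x = 0) \/ (forall x, q x = x).

Definition nice V :=
  [/\ projective V, injective_module V, exists x : V, x != 0 & indecomposable V].

(** The kernel of [f] is a direct summand of [V], so it is 0; then [f] splits because [V] is
    injective, and its image is a nonzero summand of [W]. *)
Lemma nice_hom_bij V W (f : {linear V -> W}) : nice V -> nice W ->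
  (exists x, f x != 0) -> injective f /\ forall y, exists x, f x = y.
Proof.
move=> [projV injV _ indV] [projW injW _ indW] [x0 fx0].
have [S [j [a [b [_ injj ja ba]]]]] := image_split hR f projW.
have fba x : f (b (a x)) = f x by rewrite -ja ba ja.
have [|b0|b1] := indV (linear_comp b a); first by move=> x /=; rewrite ba.
  by move: fx0; rewrite -fba [b _]b0 linear0 eqxx.
have injf : injective f.
  by apply: linear_inj => x fx; rewrite -[x]b1 /= (_ : a x = 0) ?linear0 //; apply: injj;
    rewrite ja fx linear0.
split=> // y; have [r rf] := injV V W f (linear_id V) injf.
have [|r0|r1] := indW (linear_comp f r); first by move=> z /=; rewrite rf.
  by move: fx0; rewrite -[x0]rf [f _]r0 eqxx.
by exists (r y); exact: r1.
Qed.

Section Family.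
Variables (E : lmodType R) (i : {linear R^o -> E}).
Hypothesis injE : injective_module E.
Hypothesis projE : projective E.
Hypothesis inji : injective i.
Hypothesis essi : essential_sub (fun x => exists a, i a = x).

(** Only an embedding of the image of [e] in a finite product of nice modules is required; this is
    enough for faithfulness. *)
Let decomposed (e : {linear E -> E}) :=
  exists (J : finType) (V : J -> lmodType R) (f : forall j, {linear E -> V j}),
    (forall j, nice (V j)) /\ forall x, (forall j, f j (e x) = 0) -> e x = 0.

Let decomposedD (e e1 e2 : {linear E -> E}) :
  (forall x, e x = e1 x + e2 x) -> (forall x, e1 (e x) = e1 x) -> (forall x, e2 (e x) = e2 x) ->
  decomposed e1 -> decomposed e2 -> decomposed e.
Proof.
move=> e12 e1e e2e [J1 [V1 [f1 [nice1 f1e]]]] [J2 [V2 [f2 [nice2 f2e]]]].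
pose V (j : J1 + J2) : lmodType R := match j with inl j1 => V1 j1 | inr j2 => V2 j2 end.
pose f (j : J1 + J2) : {linear E -> V j} :=
  match j with inl j1 => linear_comp (f1 j1) e1 | inr j2 => linear_comp (f2 j2) e2 end.
exists (J1 + J2)%type, V, f; split=> [[j|j]|x fx]; [exact: nice1 | exact: nice2 |].
have e1x : e1 x = 0 by apply: f1e => j; have := fx (inl j); rewrite /= e1e.
have e2x : e2 x = 0 by apply: f2e => j; have := fx (inr j); rewrite /= e2e.
by rewrite e12 e1x e2x addr0.
Qed.

Let bad := {e : {linear E -> E} | (forall x, e (e x) = e x) /\ ~ decomposed e}.

(** The image of a bad [e] is projective and injective, so it is neither zero nor indecomposable; it
    splits properly, and one of the two parts is again bad. *)
Let bad_next (e : bad) : exists e' : bad,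
  [/\ forall x, sval e (sval e' x) = sval e' x, forall x, sval e' (sval e x) = sval e' x
    & exists x, sval e x - sval e' x != 0].
Proof.
case: e => e [ee ndec] /=.
have [S [j [injj jE]]] := submod_exists (submod_im e).
have [|a aE] := @factor_inj R S E E j e injj; first by move=> x; apply/jE; exists x.
have aj s : a (j s) = s.
  apply: injj; rewrite aE; have /jE[x <-] : exists s', j s' = j s by exists s.
  exact: ee.
have projS := projective_sub hR projE injj.
have injS := injective_retract injE aj.
have SN0 : exists s : S, s != 0.
  apply: contrapT => S0; apply: ndec; exists void, (fun=> R^o), (fun=> \0); split=> [[]|x _].
  rewrite -aE (_ : a x = 0) ?linear0 //; apply/eqP/negPn/negP => axN0.
  by apply: S0; exists (a x).
have [q [qq qN0 qN1]] : exists q : {linear S -> S},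
    [/\ forall x, q (q x) = q x, exists x, q x != 0 & exists x, x - q x != 0].
  apply: contrapT => nq; apply: ndec; exists unit, (fun=> S), (fun=> a); split.
    move=> _; split=> // q qq; have [q0|] := pselect (forall x, q x = 0); first by left.
    move=> qN0; right=> x; apply/esym/eqP; rewrite -subr_eq0; apply/negPn/negP => qN1.
    apply: nq; exists q; split=> //; last by exists x.
    apply: contrapT => nqx; apply: qN0 => y; apply/eqP/negPn/negP => qy.
    by apply: nqx; exists y.
  by move=> x /(_ tt) aex; rewrite -ee -aE aex linear0.
pose e1 : {linear E -> E} := j \o (q \o a).
pose e2 : {linear E -> E} := j \o ((idfun \- q) \o a).
have e1e2 : ~ (decomposed e1 /\ decomposed e2).
  move=> [d1 d2]; apply: ndec; apply: decomposedD d1 d2 => x /=.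
  - by rewrite -linearD addrC subrK aE.
  - by rewrite -[e x]aE aj.
  - by rewrite -[e x]aE aj.
have [d1|d1] := pselect (decomposed e1).
  have d2 : ~ decomposed e2 by move=> d2; apply: e1e2.
  have e2e2 x : e2 (e2 x) = e2 x 
    by rewrite /= aj; congr (j _); rewrite [q (_ - _)]linearB /= qq subrr subr0.
  exists (exist _ e2 (conj e2e2 d2)); split=> [x|x|] /=.
  - by rewrite -aE aj.
  - by rewrite -[e x]aE aj.
  have [s qs] := qN0; exists (j s).
  rewrite -aE -linearB /= aj opprB addrC subrK.
  by apply: contra_neq qs => jq; apply: injj; rewrite linear0.
have e1e1 x : e1 (e1 x) = e1 x by rewrite /= aj qq.
exists (exist _ e1 (conj e1e1 d1)); split=> [x|x|] /=.
- by rewrite -aE aj.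
- by rewrite -[e x]aE aj.
have [s qs] := qN1; exists (j s).
rewrite -aE -linearB /= aj.
by apply: contra_neq qs => jq; apply: injj; rewrite linear0.
Qed.

Lemma nice_family : exists (J : finType) (V : J -> lmodType R) (f : forall j, {linear E -> V j}),
  (forall j, nice (V j)) /\ forall x, (forall j, f j x = 0) -> x = 0.
Proof.
suff [J [V [f [niceV fx]]]] : decomposed (linear_id E) by exists J, V, f.
apply: contrapT => nd; have [next nextP] := choice bad_next.
have id_id x : linear_id E (linear_id E x) = linear_id E x by [].
pose e n := sval (iter n next (exist _ (linear_id E) (conj id_id nd))).
have ee n x : e n (e n x) = e n x by rewrite /e; case: (iter n _ _) => /= ? [].
have eS n x : e n (e n.+1 x) = e n.+1 x by have [] := nextP (iter n next (exist _ (linear_id E) (conj id_id nd))).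
have Se n x : e n.+1 (e n x) = e n.+1 x by have [] := nextP (iter n next (exist _ (linear_id E) (conj id_id nd))).
have eSN n : exists x, e n x - e n.+1 x != 0 by have [] := nextP (iter n next (exist _ (linear_id E) (conj id_id nd))).
have ele m n x : (m <= n)%N -> e m (e n x) = e n x /\ e n (e m x) = e n x.
  elim: n x => [|n IHn] x; first by rewrite leqn0 => /eqP ->; rewrite ee.
  rewrite leq_eqVlt => /predU1P[->|]; first by rewrite ee.
  rewrite ltnS => mn; split; first by rewrite -eS (IHn _ mn).1.
  by rewrite -Se (IHn _ mn).2 Se.
(* The successive differences of the shrinking idempotents are nonzero orthogonal idempotents. *)
pose a n : {linear E -> E} := e n \- e n.+1.
apply: (no_orthogonal_sequence hR injE projE essi (a := a)) => [n x|m n x|n]; last exact: eSN.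
  by rewrite /= (linearB (e n)) (linearB (e n.+1)) /= !ee eS Se subrr subr0.
rewrite /= (linearB (e m)) (linearB (e m.+1)) /=; case: ltngtP => // [mn|nm] _.
  rewrite (ele m n _ (ltnW mn)).1 (ele m n.+1 _ (leqW (ltnW mn))).1.
  by rewrite (ele m.+1 n _ mn).1 (ele m.+1 n.+1 _ (leqW mn)).1 subrr.
rewrite (ele n m _ (ltnW nm)).2 (ele n m.+1 _ (leqW (ltnW nm))).2.
by rewrite (ele n.+1 m _ nm).2 (ele n.+1 m.+1 _ (leqW nm)).2 !subrr.
Qed.

(** By [nice_hom_bij], admitting a nonzero map is an equivalence relation; one module is kept from
    each class. The vectors [v] are the components of [i 1], transported to the representatives. *)
Lemma nice_data : exists (n : nat) (V : 'I_n -> lmodType R) (L : finType)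
    (v : L -> {j : 'I_n & V j}),
  [/\ forall j, nice (V j),
      forall j k (f : {linear V j -> V k}), j != k -> forall x, f x = 0
    & forall a : R, (forall l, a *: tagged (v l) = 0) -> a = 0].
Proof.
have [J [V [f [niceV fE]]]] := nice_family.
pose hom j k := `[< exists g : {linear V j -> V k}, exists x, g x != 0 >].
have hom_inj j k : hom j k -> exists2 g : {linear V j -> V k}, injective g &
    forall y, exists x, g x = y.
  by move=> /asboolP[g gN0]; have [] := nice_hom_bij (niceV j) (niceV k) gN0; exists g.
have inj_hom j k (g : {linear V j -> V k}) : injective g -> hom j k.
  move=> injg; apply/asboolP; exists g; have [_ _ [x xN0] _] := niceV j.
  by exists x; apply: contra_neq xN0 => gx; apply: injg; rewrite linear0.
have homxx j : hom j j by apply: (inj_hom _ _ (linear_id (V j))).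
have homC j k : hom j k -> hom k j.
  move=> /hom_inj[g injg surjg]; have [h [gh hg]] := linear_inv injg surjg.
  by apply: (inj_hom _ _ h); exact: can_inj hg.
have homT j k l : hom j k -> hom k l -> hom j l.
  move=> /hom_inj[g injg _] /hom_inj[h injh _].
  by apply: (inj_hom _ _ (linear_comp h g)) => x y /injh/injg.
pose rep j := odflt j [pick k | hom j k].
have homrep j : hom j (rep j).
  by rewrite /rep; case: pickP => //= /(_ j); rewrite homxx.
have rep_eq j k : hom j k -> rep j = rep k.
  move=> jk; rewrite /rep (@eq_pick _ (hom j) (hom k)).
    by case: pickP => //= /(_ k); rewrite homxx.
  by move=> l /=; apply/idP/idP; apply: homT => //; exact: homC.
pose reps := [pred j | rep j == j].
have repP j : rep j \in reps by rewrite inE -(rep_eq _ _ (homrep j)).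
pose W (r : 'I_#|reps|) := V (enum_val r).
have exv j : exists p : {r & W r}, forall a : R, a *: tagged p = 0 -> a *: f j (i 1) = 0.
  have [g injg _] := hom_inj _ _ (homrep j).
  suff [r [h injh]] : exists r, exists h : {linear V j -> W r}, injective h.
    exists (Tagged W (h (f j (i 1)))) => a /= ah; apply: injh.
    by rewrite linearZ /= ah linear0.
  exists (enum_rank_in (repP j) (rep j)); rewrite /W enum_rankK_in //.
  by exists g.
have [v vE] := choice exv.
exists #|reps|, W, J, v; split=> [r|r s g rs x|a av]; first exact: niceV.
  apply/eqP/negPn/negP => gx; move: rs.
  have hrs : hom (enum_val r) (enum_val s) by apply/asboolP; exists g, x.
  rewrite -(inj_eq enum_val_inj) -(eqP (enum_valP r)) -(eqP (enum_valP s)).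
  by rewrite (rep_eq _ _ hrs) eqxx.
apply: inji; rewrite linear0; apply: fE => j; have := vE j a (av j).
by rewrite -!linearZ /= (_ : a *: (1 : R^o) = a) //; exact: mulr1.
Qed.

End Family.
End NiceModules.

(** * Indecomposable projective injective modules *)

Section DivisionSpaces.
Variables (D : unitRingType) (divD : division_ring D) (M : lmodType D).

Definition spanning m (w : 'I_m -> M) :=
  forall x, exists d : 'I_m -> D, x = \sum_i d i *: w i.

(** A spanning family of least size is a basis. *)
Lemma spanning_vector_axiom m (w : 'I_m -> M) : spanning w ->
  exists n, inhabited (Vector.axiom n M).
Proof.
move=> spanw; pose P n := `[< exists w : 'I_n -> M, spanning w >].
have exP : exists n, P n by exists m; apply/asboolP; exists w.
case: (ex_minnP exP) => n /asboolP[b spanb] nmin; exists n.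
have free_b (d : 'I_n -> D) : \sum_i d i *: b i = 0 -> forall i, d i = 0.
  move=> db0 i; apply/eqP/negPn/negP => diN0.
  case: n b spanb nmin d db0 i diN0 => [|n] b spanb nmin d db0 i diN0; first by case: i diN0.
  suff : (n.+1 <= n)%N by rewrite ltnn.
  apply: nmin; apply/asboolP; exists (fun k => b (lift i k)) => x.
  have [c ->] := spanb x.
  have biE : b i = \sum_k - ((d i)^-1 * d (lift i k)) *: b (lift i k).
    move: db0; rewrite (bigD1_ord i) //= => /eqP; rewrite addr_eq0 => /eqP /(congr1 (fun y => (d i)^-1 *: y)).
    rewrite scalerA mulVr ?scale1r; last exact: divD.
    by move=> ->; rewrite scalerN scaler_sumr -sumrN; apply: eq_bigr => k _; rewrite scalerA scaleNr.
  exists (fun k => c (lift i k) - c i * ((d i)^-1 * d (lift i k))).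
  rewrite (bigD1_ord i) //= {1}biE scaler_sumr -big_split; apply: eq_bigr => k _ /=.
  by rewrite scalerA mulrN addrC -scalerDl.
have flin : linear (fun r : 'rV[D]_n => \sum_i r 0 i *: b i).
  move=> a r s; rewrite scaler_sumr -big_split; apply: eq_bigr => k _ /=.
  by rewrite !mxE scalerDl scalerA.
have [||g [fg gf]] := @linear_inv D 'rV[D]_n M (linear_of flin).
- apply: linear_inj => r /= /free_b r0; apply/rowP => k; rewrite mxE; exact: r0.
- move=> y; have [d ->] := spanb y; exists (\row_k d k) => /=.
  by apply: eq_bigr => k _; rewrite mxE.
by split; exists g; [exact: linearP | exists (linear_of flin)].
Qed.

Fixpoint span (w : seq M) (x : M) : Prop :=
  if w is a :: w' then exists d y, span w' y /\ x = d *: a + y else x = 0.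

Lemma span_sum (J : Type) (s : seq J) (d : J -> D) (w : J -> M) :
  span (map w s) (\sum_(j <- s) d j *: w j).
Proof.
elim: s => [|j s IHs]; first by rewrite big_nil.
by rewrite big_cons; exists (d j), (\sum_(k <- s) d k *: w k).
Qed.

Lemma span_submod w : submod (span w).
Proof.
elim: w => [|a w IHw]; first by split=> //= k x y -> ->; rewrite scaler0 addr0.
split=> [|k _ _ [d [x [wx ->]]] [c [y [wy ->]]]].
  by exists 0, 0; rewrite scale0r addr0; split=> //; exact: submod0 IHw.
exists (k * d + c), (k *: x + y); split; first exact: IHw.2.
by rewrite scalerDr scalerDl scalerA addrACA.
Qed.

(** Descending chain condition, by induction on [w]. If no term lies in the span of the tail, each
    term contains some [e n] congruent to [a] modulo that span, and intersecting the chain with the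
    span keeps it strict. *)
Lemma span_noetherian (w : seq M) (U : nat -> M -> Prop) (s : nat -> M) :
    (forall n, submod (U n)) -> (forall n x, U n.+1 x -> U n x) ->
    (forall n x, U n x -> span w x) -> (forall n, U n (s n)) -> (forall n, ~ U n.+1 (s n)) ->
  False.
Proof.
elim: w U s => [|a w IHw] U s subU decU Uw Us nUs.
  by apply: (nUs 0%N); rewrite [s 0%N](Uw 0%N) //; exact: (submod0 (subU 1%N)).
have subw := span_submod w.
have [[J UJ]|nJ] := pselect (exists J, forall x, U J x -> span w x).
  apply: (IHw (fun n => U (n + J)%N) (fun n => s (n + J)%N)) => [n|n x|n x|n|n] //.
  - exact: decU.
  - by elim: n x => [|n IHn] x; [exact: UJ | move=> /decU/IHn].
  - exact: nUs.
have exe n : exists e, U n e /\ span w (e - a).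
  have [e [Ue nwe]] : exists e, U n e /\ ~ span w e.
    apply: contra_notP nJ => ne; exists n => x Ux; apply: contrapT => nwx.
    by apply: ne; exists x.
  have [d [y [wy eE]]] := Uw n e Ue.
  have dN0 : d != 0 by apply: contra_notN nwe => /eqP d0; rewrite eE d0 scale0r add0r.
  exists (d^-1 *: e); split; first exact: (submodZ (subU n)).
  rewrite eE scalerDr scalerA mulVr ?scale1r; last exact: divD.
  by rewrite addrAC subrr add0r; exact: submodZ.
have [e eE] := choice exe.
have exd n : exists d : D, span w (s n - d *: a).
  have [d [y [wy ->]]] := Uw n _ (Us n).
  by exists d; rewrite addrAC subrr add0r.
have [d dE] := choice exd.
(* The correction uses [e n.+1], which lies in [U n.+1], so the corrected [s n] still lies outside
   [U n.+1]. *)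
apply: (IHw (fun n x => U n x /\ span w x) (fun n => s n - d n *: e n.+1)) => [n|n x []|n x []|n|n [Un _]] //.
- split=> [|k x y [Ux wx] [Uy wy]]; first by split; exact: submod0.
  by split; [exact: (subU n).2 | exact: subw.2].
- by move=> /decU.
- have [Ue we] := eE n.+1; split.
    by apply: (submodB (subU n)) => //; apply: (submodZ (subU n)); exact: decU.
  have -> : s n - d n *: e n.+1 = (s n - d n *: a) - d n *: (e n.+1 - a).
    by rewrite scalerBr opprB addrA subrK.
  by apply: submodB => //; exact: submodZ.
apply: (nUs n); rewrite -[s n](subrK (d n *: e n.+1)); apply: (submodD (subU n.+1)) => //.
by apply: (submodZ (subU n.+1)); have [] := eE n.+1.
Qed.

End DivisionSpaces.

Section EndomorphismDivisionRing.
Variables (R : pzRingType) (hR : ideals_projective R) (V : lmodType R) (niceV : nice V).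

(* The proofs [hR] and [niceV] are recorded in the type because the instances
   below depend on them. *)
Definition endring : Type := let _ := (hR, niceV) in lend V.
HB.instance Definition _ := GRing.PzRing.on endring.

Lemma endring_nz : (1 : endring) != 0.
Proof.
have [_ _ [x xN0] _] := niceV; apply: contra_neq xN0 => e.
exact: (congr1 (fun f : {linear V -> V} => f x) e).
Qed.
HB.instance Definition _ := GRing.PzSemiRing_isNonZero.Build endring endring_nz.

Definition endring_unit : pred endring := fun f => `[< exists g, g * f = 1 /\ f * g = 1 >].
Definition endring_inv (f : endring) : endring :=
  if pselect (exists g, g * f = 1 /\ f * g = 1) is left e then projT1 (cid e) else f.

Lemma endring_invP f : f \in endring_unit -> endring_inv f * f = 1 /\ f * endring_inv f = 1.
Proof.
by move=> /asboolP ef; rewrite /endring_inv; case: pselect => // e; case: (cid e).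
Qed.
Lemma endring_mulVr : {in endring_unit, left_inverse 1 endring_inv *%R}.
Proof. by move=> f /endring_invP[]. Qed.
Lemma endring_mulrV : {in endring_unit, right_inverse 1 endring_inv *%R}.
Proof. by move=> f /endring_invP[]. Qed.
Lemma endring_unitP f g : g * f = 1 /\ f * g = 1 -> endring_unit f.
Proof. by move=> fg; apply/asboolP; exists g. Qed.
Lemma endring_inv_out : {in [predC endring_unit], endring_inv =1 id}.
Proof.
move=> f; rewrite inE /= => nf; rewrite /endring_inv; case: pselect => // e.
by case/negP: nf; apply/asboolP.
Qed.
HB.instance Definition _ := GRing.NzRing_hasMulInverse.Build endring
  endring_mulVr endring_mulrV endring_unitP endring_inv_out.

Lemma endring_division : division_ring endring.
Proof.
move=> f fN0; have [|injf surjf] := nice_hom_bij (f := f) hR niceV niceV.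
  apply: contrapT => nf; move/eqP: fN0; apply; apply: linear_funP => x.
  by apply: contrapT => /eqP fx; apply: nf; exists x.
have [g [fg gf]] := linear_inv injf surjf.
by apply/asboolP; exists g; split; apply: linear_funP => x; [exact: fg | exact: gf].
Qed.

Definition endmod : Type := let _ := (hR, niceV) in V.
HB.instance Definition _ := GRing.Zmodule.on endmod.
Definition endmod_scale (d : endring) (x : endmod) : endmod := (d : {linear V -> V}) x.
Lemma endmod_scaleA a b v : endmod_scale a (endmod_scale b v) = endmod_scale (a * b) v.
Proof. by []. Qed.
Lemma endmod_scale1 : left_id 1 endmod_scale.
Proof. by []. Qed.
Lemma endmod_scaleDr : right_distributive endmod_scale +%R.
Proof. by move=> a u v; rewrite /endmod_scale linearD. Qed.
Lemma endmod_scaleDl v : {morph endmod_scale^~ v : a b / a + b}.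
Proof. by []. Qed.
HB.instance Definition _ := GRing.Zmodule_isLmodule.Build endring endmod
  endmod_scaleA endmod_scale1 endmod_scaleDr endmod_scaleDl.

End EndomorphismDivisionRing.

(** * Submodules of a nice module form a chain *)

Section Uniserial.
Variables (R : pzRingType) (hR : ideals_projective R) (V : lmodType R) (niceV : nice V).

Definition End_stable (U : V -> Prop) := forall (d : {linear V -> V}) x, U x -> U (d x).
Definition generates (U : V -> Prop) (x : V) := forall y, U y -> exists a : R, y = a *: x.
(** For a cyclic local module the non-generators form the largest proper submodule; the case x = 0
    makes the radical of the zero module zero. *)
Definition radical (U : V -> Prop) (x : V) := U x /\ (x = 0 \/ ~ generates U x).

Lemma nonzero_endo_inv (d : {linear V -> V}) (x : V) : d x != 0 ->
  exists g : {linear V -> V}, cancel d g /\ cancel g d.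
Proof.
move=> dx; have [|injd surjd] := nice_hom_bij hR niceV niceV (f := d); first by exists x.
exact: linear_inv injd surjd.
Qed.

(* Every nonzero endomorphism of [V] restricts to an automorphism of an
   [End_stable] submodule [U]; as [U] is projective this makes it cyclic, say
   [U = R s] with [s = f s], and [x] in [U] generates [U] as soon as
   [f R x <> 0]. *)
Lemma End_stable_local (U : V -> Prop) : submod U -> End_stable U ->
    (exists2 x, U x & x != 0) ->
  exists (s : V) (f : R), [/\ U s, f *: s != 0
    & forall x, U x -> (forall a : R, f *: (a *: x) = 0) \/ generates U x].
Proof.
move=> subU stU [x0 Ux0 x0N0]; have [projV injV _ _] := niceV.
have [S [j [injj jU]]] := submod_exists subU.
have [c cE] := projective_dual_basis (projective_sub hR projV injj).
have /jU[z0 z0E] := Ux0.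
have [t tN0] : exists t, (c t z0 : R) *: t != 0.
  apply: contrapT => nt; have [u [_ uE]] := cE z0.
  move: x0N0; rewrite -z0E uE big1 ?linear0 ?eqxx // => t _.
  by apply/eqP/negPn/negP => tN0; apply: nt; exists t.
have ext (v : V) : exists d : {linear V -> V}, forall z, d (j z) = (c t z : R) *: v.
  have hlin : linear (fun z => (c t z : R) *: v).
    by move=> a y z; rewrite linearP scalerDl -scalerA.
  exact: (injV S V j (linear_of hlin) injj).
have [d dE] := ext (j t).
have [|g [dg gd]] := @nonzero_endo_inv d (j z0).
  by rewrite dE -linearZ; apply: contra_neq tN0 => tz; apply: injj; rewrite linear0.
have Us : U (g (j t)) by apply: stU; apply/jU; exists t.
have /jU[zs zsE] := Us.
have cs z : (c t z : R) *: g (j t) = j z by rewrite -linearZ -dE dg.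
exists (g (j t)), (c t zs : R); split=> // [|x Ux].
  rewrite cs; apply: contra_neq x0N0 => zs0.
  by rewrite -z0E -cs -zsE zs0 scaler0.
have [|/existsNP[a /eqP fax]] := pselect (forall a : R, (c t zs : R) *: (a *: x) = 0).
  by left.
right=> y Uy; have [d' d'E] := ext (a *: x).
have [|g' [d'g' g'd']] := @nonzero_endo_inv d' (j zs); first by rewrite d'E.
have /jU[z zE] := stU g' _ Uy.
by exists ((c t z : R) * a); rewrite -scalerA -d'E zE g'd'.
Qed.

(** With [f] from [End_stable_local], the radical of a nonzero [U] consists of the x in [U] with f R
    x = 0. *)
Lemma radicalP (U : V -> Prop) : submod U -> End_stable U ->
  submod (radical U) /\ End_stable (radical U).
Proof.
move=> subU stU; have [exx|U0] := pselect (exists2 x, U x & x != 0); last first.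
  have rad0 x : radical U x <-> x = 0.
    split=> [[Ux _]|->]; last by split; [exact: submod0 | left].
    by apply: contrapT => /eqP xN0; apply: U0; exists x.
  split; first by split=> [|a x y /rad0 -> /rad0 ->]; apply/rad0; rewrite ?scaler0 ?addr0.
  by move=> d x /rad0 ->; apply/rad0; rewrite linear0.
have [s [f [Us fs fx]]] := End_stable_local subU stU exx.
have radE x : radical U x <-> U x /\ forall a : R, f *: (a *: x) = 0.
  split=> [[Ux [->|nx]]|[Ux fax]].
  - by split=> [|a]; [exact: submod0 | rewrite !scaler0].
  - by split=> //; have [|/nx] := fx x Ux.
  split=> //; right=> /(_ s Us)[a sE]; move: fs; rewrite sE fax eqxx //.
split; last by move=> d x /radE[Ux fax]; apply/radE; split=> [|a]; [exact: stU | rewrite -!linearZ fax linear0].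
split=> [|a x y /radE[Ux fx0] /radE[Uy fy0]].
  by apply/radE; split=> [|a]; [exact: submod0 | rewrite !scaler0].
apply/radE; split=> [|b]; first exact: subU.2.
by rewrite !scalerDr (scalerA b) fx0 fy0 addr0.
Qed.

Lemma radical_proper (U : V -> Prop) : submod U -> End_stable U ->
  (exists2 x, U x & x != 0) -> exists2 s, U s & ~ radical U s.
Proof.
move=> subU stU exx; have [s [f [Us fs fx]]] := End_stable_local subU stU exx.
exists s => // -[_ [s0|]]; first by rewrite s0 scaler0 eqxx in fs.
by apply; have [fs0|//] := fx s Us; move: fs; rewrite -[s]scale1r fs0 eqxx.
Qed.

Fixpoint radical_series n : V -> Prop :=
  if n is n'.+1 then radical (radical_series n') else fun=> True.

Lemma radical_seriesP n : submod (radical_series n) /\ End_stable (radical_series n).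
Proof. by elim: n => [|n [subU stU]] //; exact: radicalP. Qed.

Lemma radical_series_decr m n x : (m <= n)%N -> radical_series n x -> radical_series m x.
Proof.
move=> /subnK <-; by elim: (n - m)%N => [|k IHk] // [/IHk].
Qed.

(** If [T] lies in one term but not in the next, it contains a generator of the former and equals
    it. *)
Lemma submod_radical_series (T : V -> Prop) k : submod T ->
    (forall x, radical_series k x -> x = 0) ->
  exists2 n, (n <= k)%N & forall x, T x <-> radical_series n x.
Proof.
move=> subT k0.
have IH n : (forall x, T x -> radical_series n x) \/
    exists2 m, (m <= n)%N & forall x, T x <-> radical_series m x.
  elim: n => [|n [IHn|[m mn mE]]]; [by left | | by right; exists m => //; exact: leqW].
  have [|/existsNP[x /not_implyP[Tx nrx]]] := pselect (forall x, T x -> radical_series n.+1 x).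
    by left.
  right; exists n => // y; split=> [/IHn //|].
  have gx : generates (radical_series n) x.
    by apply: contrapT => ngx; apply: nrx; split; [exact: IHn | right].
  by move=> /gx[a ->]; exact: (submodZ subT).
have [Tk|[n nk nE]] := IH k; last by exists n.
exists k => // x; split; first exact: Tk.
by move=> /k0 ->; exact: submod0.
Qed.

End Uniserial.

Section NiceBlock.
Variables (R : pzRingType) (hR : ideals_projective R) (V : lmodType R) (niceV : nice V).
Variables (m : nat) (w : 'I_m -> V).
Hypothesis span_w : forall x, exists d : 'I_m -> {linear V -> V}, x = \sum_i d i (w i).

Local Notation D := (endring hR niceV).
Local Notation M := (endmod hR niceV).

Lemma endmod_submod (U : V -> Prop) : submod U -> End_stable U -> @submod D M U.
Proof.
move=> subU stU; split=> [|d x y Ux Uy]; first exact: (submod0 subU).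
exact: (submodD subU (stU d x Ux) Uy).
Qed.

Lemma radical_series_end : exists k, forall x, radical_series (V := V) k x -> x = 0.
Proof.
apply: contrapT => nk.
have exs n : exists s, radical_series (V := V) n s /\ ~ radical_series n.+1 s.
  have [subU stU] := radical_seriesP hR niceV n.
  have [|s Us nUs] := radical_proper hR niceV subU stU; last by exists s.
  apply: contra_notP nk => ne; exists n => x Ux; apply/eqP/negPn/negP => xN0.
  by apply: ne; exists x.
have [s sE] := choice exs.
apply: (@span_noetherian D (@endring_division _ hR _ niceV) M (map w (enum 'I_m))
  (radical_series (V := V)) s) => [n|n x|n x _|n|n].
- by have [subU stU] := radical_seriesP hR niceV n; exact: endmod_submod.
- exact: radical_series_decr.
- have [d xE] := span_w x; rewrite [x]xE -[X in span _ X]big_enum.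
  exact: (span_sum (D := D) (M := M) (enum 'I_m) d w).
- exact: (sE n).1.
- exact: (sE n).2.
Qed.

(** The block is [V] over its endomorphism ring with its radical series as chain. The map [th] turns
    elements of the stabilizer ring into maps of [V] that commute with endomorphisms and preserve
    all submodules. *)
Lemma nice_block : exists (b : block) (p : {rmorphism R -> stabilizer_ring (@block_chain b)})
    (th : stabilizer_ring (@block_chain b) -> V -> V),
  [/\ forall a x, th (p a) x = a *: x, forall s t, th s =1 th t -> s = t,
      forall s, {morph th s : x y / x + y},
      forall s (d : {linear V -> V}) x, th s (d x) = d (th s x)
    & forall s (T : V -> Prop), submod T -> forall x, T x -> T (th s x)].
Proof.
have spanM : @spanning D M m w by move=> x; have [d ->] := span_w x; exists d.
have [n [ax]] := spanning_vector_axiom (@endring_division _ hR _ niceV) spanM.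
pose VT : vectType D := HB.pack M (Lmodule_hasFinDim.Build D M ax).
have [k k0] := radical_series_end.
have subU (i : 'I_k.+1) : @submod D VT (radical_series (V := V) i).
  by have [subU stU] := radical_seriesP hR niceV i; exact: endmod_submod.
pose U (i : 'I_k.+1) : submodClosed VT := submod_pred (subU i).
have UE i (x : VT) : (x \in U i) = `[< radical_series (V := V) i x >] by [].
have chainU : subspace_chain U.
  split=> [i j ij x|x]; last by rewrite UE => /asboolP/k0.
  by rewrite !UE => /asboolP/(radical_series_decr ij)/asboolP.
pose b := Block (@endring_division _ hR _ niceV) chainU.
have mul_lin (a : R) : @GRing.linear_for D VT VT *:%R (fun x : V => a *: x).
  by move=> d x y; rewrite scalerDr; congr (_ + _); rewrite -[d *: x]/((d : {linear V -> V}) x) -linearZ.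
have mul_stable a : (linear_of (mul_lin a) : lend VT) \in stabilizer U.
  apply/asboolP => i x /=; rewrite !UE => /asboolP Ux; apply/asboolP.
  by have [subV _] := radical_seriesP hR niceV i; exact: submodZ.
pose p0 a : stabilizer_ring U := StabilizerRing (mul_stable a).
have p0B : {morph p0 : x y / x - y}.
  move=> x y; apply: val_inj; apply: linear_funP => v; rewrite (rmorphB (val : {rmorphism stabilizer_ring U -> lend VT})) /=.
  by rewrite scalerBl.
have p0M : monoid_morphism p0.
  split=> [|x y]; apply: val_inj; apply: linear_funP => v; first exact: (scale1r (v : V)).
  exact/esym/(scalerA x y (v : V)).
pose p : {rmorphism R -> stabilizer_ring U} :=
  HB.pack p0 (GRing.isZmodMorphism.Build R (stabilizer_ring U) p0 p0B)
    (GRing.isMonoidMorphism.Build R (stabilizer_ring U) p0 p0M).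
pose th (s : stabilizer_ring U) : V -> V := (val s : {linear VT -> VT}).
exists b, p, th; split=> //.
- by move=> s t st; apply: val_inj; exact: linear_funP.
- by move=> s x y; exact: linearD.
- by move=> s d x; exact: (linearZ_LR (val s : {linear VT -> VT}) (d : D) x).
move=> s T subT x Tx; have [j jk jE] := submod_radical_series subT k0.
have /asboolP := valP s => /(_ (Ordinal (jk : (j < k.+1)%N)) x).
rewrite !UE => /(_ (introT (asboolP _) ((jE x).1 Tx))) /asboolP.
by move=> /jE.
Qed.

End NiceBlock.

(** * The ring as a product of blocks *)

Section Necessity.
Variables (R : pzRingType) (hR : ideals_projective R).
Variables (n : nat) (V : 'I_n -> lmodType R) (L : finType) (v : L -> {j : 'I_n & V j}).
Hypothesis niceV : forall j, nice (V j).
Hypothesis homV0 : forall j k (f : {linear V j -> V k}), j != k -> forall x, f x = 0.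
Hypothesis faithful_v : forall a : R, (forall l, a *: tagged (v l) = 0) -> a = 0.
Implicit Types K S T W X : lmodType R.

Let V_image_split K j (f : {linear K -> V j}) :
  exists W (i : {linear W -> V j}) (a : {linear K -> W}) (b : {linear W -> K}),
    [/\ projective W, injective i, forall x, i (a x) = f x & cancel b a].
Proof. by have [projV _ _ _] := niceV j; exact: image_split. Qed.

Let scale_linear K (k : {linear K -> R^o}) (j : 'I_n) (y : V j) :
  linear (fun x => (k x : R) *: y).
Proof. by move=> a x z; rewrite linearP scalerDl -scalerA. Qed.

(** Induction on [s]: after subtracting a sum that agrees with [h] on the kernel of x |-> x v l, the
    difference factors through the image of this map and extends to an [e] on the whole module,
    because [V j] is injective. *)
Let hom_span (s : seq L) K (k : {linear K -> R^o}) j (h : {linear K -> V j}) : uniq s ->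
    (forall x, (forall l, l \in s -> (k x : R) *: tagged (v l) = 0) -> x = 0) ->
  exists d : forall l, {linear V (tag (v l)) -> V j},
    forall x, h x = \sum_(l <- s) d l ((k x : R) *: tagged (v l)).
Proof.
elim: s K k h => [|l s IHs] K k h /= => [_ kx|/andP[ls us] kx].
  by exists (fun=> \0) => x; rewrite big_nil [x]kx ?linear0.
pose f : {linear K -> V (tag (v l))} := linear_of (scale_linear k (tagged (v l))).
have [W [i [a [b [projW inji ia ba]]]]] := V_image_split f.
have [K' [k' [injk' kerf]]] := submod_exists (submod_ker f).
have [|d dE] := IHs K' (linear_comp k k') (linear_comp h k') us.
  move=> x sx; apply: injk'; rewrite linear0; apply: kx => l'.
  by rewrite inE => /predU1P[->|/sx //]; apply/kerf; exists x.
have glin : linear (fun x => h x - \sum_(l' <- s) d l' ((k x : R) *: tagged (v l'))).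
  move=> t x y; rewrite linearP.
  under eq_bigr do rewrite linearP scalerDl -scalerA linearP.
  by rewrite big_split /= -scaler_sumr opprD addrACA -scalerBr.
pose g : {linear K -> V j} := linear_of glin.
have [_ injV _ _] := niceV j; have [e eE] := injV _ _ i (linear_comp g b) inji.
have gE x : g x = e (f x).
  have /kerf[y yE] : f (x - b (a x)) = 0 by rewrite linearB -!ia ba subrr.
  have : g (x - b (a x)) = 0 by rewrite -yE /= [h _]dE /= subrr.
  by rewrite -ia eE linearB => /eqP; rewrite subr_eq0 => /eqP.
exists (dfwith d e) => x; rewrite big_cons dfwith_in -[_ *: _]/(f x) -gE /=.
rewrite [X in _ + X](eq_big_seq (fun l' => d l' ((k x : R) *: tagged (v l')))) ?subrK //.
by move=> l' l's; rewrite dfwith_out //; apply: contraNneq ls => ->.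
Qed.

Lemma nice_spanning j : exists m (w : 'I_m -> V j),
  forall x, exists d : 'I_m -> {linear V j -> V j}, x = \sum_i d i (w i).
Proof.
(* A vector in another nice module contributes nothing to [V j], so it is replaced by 0. *)
have exw l : exists w : V j, forall d : {linear V (tag (v l)) -> V j},
    exists e : {linear V j -> V j}, d (tagged (v l)) = e w.
  have [lj|lj] := eqVneq (tag (v l)) j.
    by case: (v l) lj => k y /= kj; subst k; exists y => d; exists d.
  by exists 0 => d; exists \0; rewrite (homV0 d lj).
have [w wE] := choice exw.
exists #|L|, (fun i => w (enum_val i)) => x.
have hlin : linear (fun a : R^o => (a : R) *: x) by move=> a y z; rewrite scalerDl -scalerA.
have [|d dE] := @hom_span (enum L) R^o (linear_id R^o) j (linear_of hlin) (enum_uniq _).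
  by move=> a sa; apply: faithful_v => l; apply: sa; rewrite mem_enum.
have [e eE] := choice (fun l => wE l (d l)).
exists (fun i => e (enum_val i)); rewrite -(big_enum_val (fun l => e l (w l))) /=.
have := dE 1; rewrite /= scale1r big_enum /= => ->.
by apply: eq_bigr => l _; rewrite scale1r eE.
Qed.

(** Induction on [s], for left ideals [K]: [x] splits into a part killing v l, covered by induction,
    and a part coming from a submodule [W] of a nice module, on which [phi] acts because it
    preserves submodules. *)
Let realize (phi : forall j, V j -> V j) (s : seq L) K (k : {linear K -> R^o}) :
    (forall j, {morph phi j : x y / x + y}) ->
    (forall j (d : {linear V j -> V j}) x, phi j (d x) = d (phi j x)) ->
    (forall j (T : V j -> Prop), submod T -> forall x, T x -> T (phi j x)) ->
    (forall x, (forall l, l \in s -> (k x : R) *: tagged (v l) = 0) -> x = 0) ->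
  forall x, exists a : R, forall j (y : V j), a *: y = phi j ((k x : R) *: y).
Proof.
move=> phiD phi_end phi_sub.
have phi0 j : phi j 0 = 0 by apply: (addIr (phi j 0)); rewrite -phiD !add0r.
have phi_hom j j' (d : {linear V j -> V j'}) x : phi j' (d x) = d (phi j x).
  by have [jj'|jj'] := eqVneq j j'; [subst j' | rewrite !(homV0 d jj')].
elim: s K k => [|l s IHs] K k kx x.
  by exists 0 => j y; rewrite [x]kx // linear0 scale0r phi0.
pose f : {linear K -> V (tag (v l))} := linear_of (scale_linear k (tagged (v l))).
have [W [i [a [b [projW inji ia ba]]]]] := V_image_split f.
have [K' [k' [injk' kerf]]] := submod_exists (submod_ker f).
have /kerf[y yE] : f (x - b (a x)) = 0 by rewrite linearB -!ia ba subrr.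
have [|c cE] := IHs K' (linear_comp k k') _ y.
  move=> z sz; apply: injk'; rewrite linear0; apply: kx => l'.
  by rewrite inE => /predU1P[->|/sz //]; apply/kerf; exists z.
have [y1 y1E] := phi_sub _ _ (submod_im i) (i (a x)) (ex_intro _ (a x) erefl).
exists (c + k (b y1)) => j z.
have -> : (k x : R) = (k (k' y) : R) + k (b (a x)).
  by rewrite -[RHS]linearD /= yE subrK.
rewrite !scalerDl phiD cE; congr (_ + _).
have [_ injV _ _] := niceV j.
(* The map w |-> k (b w) z on [W] extends to a map [d] of nice modules, and [phi] commutes with [d];
   so [k (b y1)] acts on z as required. *)
have [d dE] := injV _ _ i (linear_comp (linear_of (scale_linear k z)) b) inji.
by rewrite -[LHS]dE y1E -phi_hom dE.
Qed.

Theorem nice_product_blocks : finite_product_blocked_triangular R.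
Proof.
pose Q j (b : block) (p : {rmorphism R -> stabilizer_ring (@block_chain b)})
    (th : stabilizer_ring (@block_chain b) -> V j -> V j) :=
  [/\ forall a x, th (p a) x = a *: x, forall s t, th s =1 th t -> s = t,
      forall s, {morph th s : x y / x + y},
      forall s (d : {linear V j -> V j}) x, th s (d x) = d (th s x)
    & forall s (T : V j -> Prop), submod T -> forall x, T x -> T (th s x)].
have exb j : exists b p th, @Q j b p th.
  by have [m [w span_w]] := nice_spanning j; exact: (nice_block hR (niceV j) span_w).
have [b exp] := choice exb.
pose p j := projT1 (cid (exp j)).
have exth j : exists th, @Q j (b j) (p j) th := projT2 (cid (exp j)).
pose th j := projT1 (cid (exth j)).
have thP j : @Q j (b j) (p j) (th j) := projT2 (cid (exth j)).
exists n, (fun j => stabilizer_ring (@block_chain (b j))); split=> [j|].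
  exists (block_ring (b j)); split; first exact: block_division.
  exists (block_space (b j)), (block_length (b j)), (@block_chain (b j)).
  split; first exact: block_chainP.
  by exists idfun, id.
exists p.
have surj (s : forall j, stabilizer_ring (@block_chain (b j))) : exists a, forall j, p j a = s j.
  (* For K = R and x = 1, [realize] yields one ring element acting as every [s j] at once. *)
  have [||||a aE] := @realize (fun j => th j (s j)) (enum L) R^o (linear_id R^o) _ _ _ _ 1.
  - by move=> j; have [_ _ + _ _] := thP j; apply.
  - by move=> j; have [_ _ _ + _] := thP j; apply.
  - by move=> j; have [_ _ _ _ +] := thP j; apply.
  - by move=> a sa; apply: faithful_v => l; apply: sa; rewrite mem_enum.
  exists a => j; have [thp th_inj _ _ _] := thP j; apply: th_inj => y.
  by rewrite thp aE /= scale1r.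
have [g gE] := choice surj.
exists g => [a|s]; last by apply: functional_extensionality_dep => j; exact: gE.
apply/eqP; rewrite -subr_eq0; apply/eqP/faithful_v => l.
have [thp _ _ _ _] := thP (tag (v l)).
by rewrite scalerBl -!thp gE subrr.
Qed.

End Necessity.

Lemma projective_envelope_product_blocks (R : pzRingType) :
  ideals_projective R -> projective_injective_envelope R -> finite_product_blocked_triangular R.
Proof.
move=> hR [E [i [[injE /essential_monoP[inji essi]] projE]]].
have [n [V [L [v [niceV homV0 faithful_v]]]]] := nice_data hR injE projE inji essi.
exact: (nice_product_blocks hR niceV homV0 faithful_v).
Qed.

Theorem theorem9p5 (Lambda : pzRingType) :
  (left_hereditary Lambda ->
     (abelian (stable_category Lambda) <->
      projective_injective_envelope Lambda)) /\
  (left_hereditary Lambda /\ projective_injective_envelope Lambda <->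
   finite_product_blocked_triangular Lambda).
Proof.
split=> [/left_hereditaryP hR|].
  split; first exact: abelian_projective_envelope.
  (* That a projective envelope makes the stable category abelian is obtained through the structure
     theorem. *)
  by move=> /(projective_envelope_product_blocks hR)/product_blocks_sufficient[].
split; last by move=> /product_blocks_sufficient[].
by move=> [/left_hereditaryP hR]; exact: projective_envelope_product_blocks.
Qed.
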